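(* The process $Z$ is Feller if and only if $G^i$ is continuous for all $i\in E$.
   Context: Data. $E=\{1,\dots,N\}$ is a finite set, $\mathbb{R}_+=[0,\infty)$. For each $i\in E$: $F^i$ is a smooth, forward-complete vector field on $\mathbb{R}^d$, i.e. for every $x$ the maximal solution $t\mapsto\varphi^i_t(x)$ of $\dot x=F^i(x)$ started at $x$ is defined on an interval $(-s^i(x),\infty)$ with $s^i(x)\in(0,\infty]$; $\mu^i$ is a Borel probability measure on $\mathbb{R}_+$ with $\mu^i(\{0\})=0$, $G^i(t):=\mu^i((t,\infty))$, $\bar t^i:=\inf\{t\ge0:G^i(t)=0\}$ ($\inf\emptyset=+\infty$); $\lambda^i:\mathbb{R}^d\to\mathbb{R}_+$ is continuous, with $0<\inf_{x,i}\lambda^i(x)\le\sup_{x,i}\lambda^i(x)<\infty$. The map $x\mapsto Q(x)=(q_{i,j}(x))_{i,j\in E}$ is continuous and each $Q(x)$ is an irreducible stochastic matrix with zeros on the diagonal. State space. $K=\{(x,s,i)\in\mathbb{R}^d\times\mathbb{R}_+\times E: s<s^i(x),\ \int_{-s}^0\lambda^i(\varphi^i_r(x))\,dr<\bar t^i\}$ with the subspace topology. For $z=(x,s,i)\in K$ and $t\ge0$, $G_z(t)=G^i\big(\int_{-s}^t\lambda^i(\varphi^i_r(x))\,dr\big)/G^i\big(\int_{-s}^0\lambda^i(\varphi^i_r(x))\,dr\big)$. Process. Let $(U_k)_{k\ge1}$, $(V_k)_{k\ge1}$ be independent i.i.d. sequences of uniform variables on $(0,1]$ and $\psi_z(u)=\inf\{r\ge0:G_z(r)\le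 u\}$. For $z=(x,s,i)\in K$ put $T_0=0$, $\mathbf{Z}_0=(\mathbf{X}_0,\boldsymbol{\tau}_0,\mathbf{I}_0)=z$, and for $k\ge1$: $S_k=\psi_{\mathbf{Z}_{k-1}}(U_k)$, $T_k=T_{k-1}+S_k$, $\mathbf{X}_k=\varphi^{\mathbf{I}_{k-1}}_{S_k}(\mathbf{X}_{k-1})$, $\boldsymbol{\tau}_k=0$, $\mathbf{I}_k=j$ if $\sum_{l<j}q_{\mathbf{I}_{k-1},l}(\mathbf{X}_k)<V_k\le\sum_{l\le j}q_{\mathbf{I}_{k-1},l}(\mathbf{X}_k)$, $\mathbf{Z}_k=(\mathbf{X}_k,\boldsymbol{\tau}_k,\mathbf{I}_k)$. For $T_k\le t<T_{k+1}$, $Z_t=(X_t,\tau_t,I_t)=(\varphi^{\mathbf{I}_k}_{t-T_k}(\mathbf{X}_k),\boldsymbol{\tau}_k+t-T_k,\mathbf{I}_k)$. This is a Markov process on $K$ with Markov semigroup $(P_t)_{t\ge0}$, $P_tf(z)=\mathbb{E}_z[f(Z_t)]$. Feller. A Markov semigroup $(Q_t)_{t\ge0}$ on a metric space $\mathcal{M}$ is Feller if for all continuous bounded $f:\mathcal{M}\to\mathbb{R}$, the function $(t,x)\mapsto Q_tf(x)$ is continuous and bounded on $[0,\infty)\times\mathcal{M}$. $Z$ is Feller if $(P_t)$ is. *)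

(* Defs.v *)
From HB Require Import structures.
From mathcomp Require Import all_boot all_order all_algebra.
From mathcomp Require Import all_classical all_reals all_analysis.

Set Implicit Arguments.
Unset Strict Implicit.
Unset Printing Implicit Defensive.

Import Order.TTheory GRing.Theory Num.Theory.
Import numFieldNormedType.Exports.

Local Open Scope classical_set_scope.
Local Open Scope ring_scope.

Section vector_fields.
Context {R : realType} {d : nat}.
Implicit Types (F : 'rV[R]_d -> 'rV[R]_d) (x : 'rV[R]_d) (y : R -> 'rV[R]_d).

Fixpoint Ck (k : nat) F : Prop :=
  if k is k'.+1 then
    (forall x, differentiable F x) /\ (forall v, Ck k' ('D_v F))
  else continuous F.

Definition smooth F := forall k, Ck k F.

Definition solves_on F (a b : \bar R) y :=
  forall t : R, (a < t%:E < b)%E -> is_derive t 1 y (F (y t)).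

(* For every [x] the maximal solution of the Cauchy problem y' = F y, y 0 = x
   is [phi ^~ x], with interval of existence ]- s x, +oo[.  Nothing is said
   about [phi t x] for [t <= - s x]. *)
Definition forward_complete_flow F (phi : R -> 'rV[R]_d -> 'rV[R]_d)
    (s : 'rV[R]_d -> \bar R) :=
  forall x, [/\ (0 < s x)%E,
    phi 0 x = x,
    solves_on F (- s x)%E +oo%E (phi ^~ x) &
    forall (a b : \bar R) y, (a < 0 < b)%E -> y 0 = x ->
      solves_on F a b y -> (- s x <= a)%E].

End vector_fields.

Section stochastic_matrices.
Context {R : realType} {N : nat}.
Implicit Type q : 'M[R]_N.

Definition stochastic q :=
  (forall i j, 0 <= q i j) /\ (forall i, \sum_j q i j = 1).

Definition irreducible q := forall i j, exists n : nat, 0 < (q ^+ n) i j.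

End stochastic_matrices.

(* [phi i] and [life i] are determined by [F i] through [phi_flow].
   A Borel probability measure on [0, +oo[ is encoded as a Borel probability
   measure on R giving mass 1 to [0, +oo[. *)
Record switching (R : realType) (d N : nat) := Switching {
  F : 'I_N -> 'rV[R]_d -> 'rV[R]_d ;
  phi : 'I_N -> R -> 'rV[R]_d -> 'rV[R]_d ;
  life : 'I_N -> 'rV[R]_d -> \bar R ;
  mu : 'I_N -> probability (measurableTypeR R) R ;
  lambda : 'I_N -> 'rV[R]_d -> R ;
  Q : 'rV[R]_d -> 'M[R]_N ;
  F_smooth : forall i, smooth (F i) ;
  phi_flow : forall i, forward_complete_flow (F i) (phi i) (life i) ;
  mu_nneg : forall i, mu i `[0%R, +oo[%classic = 1%E ;
  mu_at0 : forall i, mu i [set 0] = 0%E ;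
  lambda_ge0 : forall i x, 0 <= lambda i x ;
  lambda_continuous : forall i, continuous (lambda i) ;
  lambda_inf : (0 < ereal_inf [set (lambda i x)%:E | i in setT & x in setT])%E ;
  lambda_sup : (ereal_sup [set (lambda i x)%:E | i in setT & x in setT] < +oo)%E ;
  Q_continuous : continuous Q ;
  Q_stochastic : forall x, stochastic (Q x) ;
  Q_irreducible : forall x, irreducible (Q x) ;
  Q_diag0 : forall x i, Q x i i = 0
}.

Section process.
Context {R : realType} {d N : nat} (D : switching R d N).

Local Notation space := ('rV[R]_d * R * discrete_topology 'I_N)%type.
Implicit Types (i j : 'I_N) (x : 'rV[R]_d) (t : R).

Definition G i t : R := fine (mu D i `]t, +oo[%classic).

Definition tbar i : \bar R :=
  ereal_inf [set t%:E | t in [set t : R | 0 <= t /\ G i t = 0]].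

Definition hazard i x (s t : R) : R :=
  \int[lebesgue_measure]_(r in `[- s, t]) lambda D i (phi D i r x).

Definition K : set space := [set z | let: (x, s, i) := z in
  [/\ 0 <= s, (s%:E < life D i x)%E & ((hazard i x s 0)%:E < tbar i)%E]].

Definition Gz (z : space) t : R :=
  let: (x, s, i) := z in G i (hazard i x s t) / G i (hazard i x s 0).

Definition psi (z : space) (u : R) : R := inf [set r | 0 <= r /\ Gz z r <= u].

Definition flow (z : space) t : space :=
  let: (x, s, i) := z in (phi D i t x, s + t, i).

Definition next_index i x (v : R) : 'I_N :=
  odflt i [pick j : 'I_N |
    \sum_(l < N | (l < j)%N) Q D x i l < v <= \sum_(l < N | (l <= j)%N) Q D x i l].

Section trajectory.
Variables (u v : nat -> R) (z : K).

(* [skeleton k] is (T_k, Z_k); the values [u 0] and [v 0] are not used. *)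
Fixpoint skeleton (k : nat) : R * space :=
  if k is k'.+1 then
    let: (T, (x, s, i)) := skeleton k' in
    let S := psi (x, s, i) (u k) in
    let x' := phi D i S x in
    (T + S, (x', 0, next_index i x' (v k)))
  else (0, val z).

Definition jump_time k : R := (skeleton k).1.

Definition post_jump k : space := (skeleton k).2.

(* The default value [z] only matters on the null event where the jump times
   accumulate before [t]: otherwise there is exactly one [k] with
   T_k <= t < T_k.+1, and when the [u k] and [v k] lie in ]0, 1] the flowed
   state belongs to [K]. *)
Definition state_at t : K :=
  insubd z (xget (val z) [set y | exists2 k : nat,
    jump_time k <= t < jump_time k.+1 & y = flow (post_jump k) (t - jump_time k)]).

End trajectory.

End process.

Section randomness.
Context {R : realType} {dO : measure_display} {Omega : measurableType dO}
  (P : probability Omega R).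

Definition mutually_independent (I : eqType) (X : I -> {RV P >-> R}) :=
  forall (s : seq I) (A : I -> set R), uniq s ->
    (forall i, measurable (A i)) ->
    P (\bigcap_(i in [set` s]) (X i @^-1` A i)) =
    (\prod_(i <- s) P (X i @^-1` A i))%E.

(* [uniform_prob] is supported by [0, 1]; as a law on R it is the uniform law
   on ]0, 1]. *)
Definition uniform01 (X : {RV P >-> R}) :=
  (forall w, 0 < X w <= 1) /\
  (forall A, measurable A -> distribution P X A = uniform_prob (@ltr01 R) A).

Definition iid_uniform_pair (U V : nat -> {RV P >-> R}) :=
  [/\ forall k, uniform01 (U k), forall k, uniform01 (V k) &
      mutually_independent (fun k : nat + nat =>
        match k with inl n => U n | inr n => V n end)].

End randomness.

Definition semigroup (R : realType) (d N : nat) (D : switching R d N)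
    (dO : measure_display) (Omega : measurableType dO)
    (P : probability Omega R) (U V : nat -> {RV P >-> R})
    (t : R) (f : K D -> R) (z : K D) : R :=
  fine 'E_P[fun w => f (state_at (U ^~ w) (V ^~ w) z t)].

Arguments semigroup {R d N} D {dO Omega P} U V t f z.

Definition feller (R : realType) (M : topologicalType)
    (Qt : R -> (M -> R) -> M -> R) :=
  forall f : M -> R, continuous f -> bounded_fun f ->
    {within [set p : R * M | 0 <= p.1], continuous (fun p => Qt p.1 f p.2)} /\
    [bounded Qt p.1 f p.2 | p in [set p : R * M | 0 <= p.1]].

(* Main.v *)
Require Import Defs.
From HB Require Import structures.
From mathcomp Require Import all_boot all_order all_algebra.
From mathcomp Require Import all_classical all_reals all_analysis.
From mathcomp Require Import measurable_realfun ring lra.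
Import Order.TTheory GRing.Theory Num.Theory.
Import numFieldNormedType.Exports.
Local Open Scope classical_set_scope.
Local Open Scope ring_scope.

(** The process jumps when the survival function, evaluated along the
    accumulated hazard, drops below a uniform variable.  Everything in its
    construction depends continuously on the starting point, on time and on the
    uniform variables outside an exceptional event, and this event is null when
    each G^i is continuous.

    Sufficiency.  Fix a starting point z and a time t.  Four things can spoil
    continuity: a uniform variable U_k hits a level on which the survival function
    G_z is flat, so that its generalized inverse psi jumps; V_k hits a partial sum
    of a row of Q; a jump occurs exactly at time t; or the jump times accumulate.
    A flat stretch contains a rational time, and for continuous G^i a jump at time
    t forces U_k to be the value of the survival function at that time, so each of
    the first three events says that one uniform variable equals a quantity
    computed from the preceding ones.  Such a coincidence is null
    ([almost_surely_neq]).  The fourth event is null because a post-jump state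
    survives a fixed time e with probability more than 1/2, whatever the state
    ([uniform_survival], [jump_time_unbounded]).  Off these null events the
    trajectory is sequentially continuous ([state_at_cvg]), and bounded convergence
    gives joint continuity of the semigroup ([semigroup_continuous]).

    Measurability of random states comes from the same continuity.  Each uniform
    variable is rounded to a finite grid and all but finitely many of them are
    replaced by 1; any functional whatsoever of the rounded variables is a simple
    random variable ([coarse_measurable]), and the true state is an almost sure
    limit of such functionals.  The rounding also turns independence into a finite
    sum over cells, which is how [almost_surely_neq] is proved
    ([coarse_independent]).  Where measurability is unknown the integral is the
    supremum over simple functions below, which null sets do not change
    ([lower_integral_off_null]).

    Continuity of the flow in all its arguments, backward in time as well since the
    hazard looks back by the age s, rests on a Gronwall estimate
    ([trajectory_close]).  The lifetimes are lower semicontinuous: otherwise a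
    backward trajectory near x would stay bounded while reaching the end of its
    lifetime, and flowing forward from one of its cluster points would extend it
    ([life_lower_semicontinuous]).

    Necessity.  Suppose that G^i has a downward jump of size at least e at some
    a > 0, and start at age 0 in state i.  With T the time at which the hazard
    reaches a, the first jump occurs exactly at T with probability at least e.  The
    age truncated at T is a bounded continuous function of the state; it grows at
    most at unit speed, every jump resets it to 0, and on that event it drops by T.
    Hence its expectation at time T lies at least T * e below its left limit
    ([semigroup_gap], [no_survival_gap]); as all comparisons are pointwise, they
    survive integration without any measurability of the state. *)

Set Implicit Arguments.
Unset Strict Implicit.
Unset Printing Implicit Defensive.

(** * Gronwall's inequality and locally Lipschitz vector fields *)

Section gronwall.
Context {R : realType}.

(** The differential inequality is available only below the barrier r.  It
    keeps E strictly below r as long as it applies, so E has no first time at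
    which it could reach r. *)
Lemma gronwall_barrier (E dE : R -> R) (C r b : R) :
  0 <= C -> 0 <= E 0 ->
  (forall t, 0 <= t <= b -> is_derive t 1 E (dE t)) ->
  (forall t, 0 <= t <= b -> E t < r -> dE t <= C * E t) ->
  E 0 * expR (C * b) < r ->
  forall t, 0 <= t <= b -> E t <= E 0 * expR (C * t).
Proof.
move=> C0 E0 dEP dEC Er.
have cE t : 0 <= t <= b -> {for t, continuous E}.
  move=> /dEP dt; apply: differentiable_continuous.
  exact/derivable1_diffP/(@ex_derive _ _ _ _ _ _ _ dt).
have step t : 0 <= t <= b -> (forall s, 0 <= s < t -> E s < r) ->
    E t <= E 0 * expR (C * t).
  move=> /andP[t0 tb] Es.
  move: t0; rewrite le_eqVlt => /predU1P[<-|t0]; first by rewrite mulr0 expR0 mulr1.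
  pose h (s : R) : R := E s * expR (- C * s).
  pose dh (s : R) : R := (dE s - C * E s) * expR (- C * s).
  have hD s : 0 <= s <= b -> is_derive s 1 h (dh s).
    move=> /dEP dEs; apply: is_derive_eq.
    rewrite /dh /GRing.scale /=; ring.
  have [||c] := @MVT R h dh 0 t t0.
  - move=> s; rewrite in_itv/= => /andP[s0 st].
    by apply: hD; rewrite (ltW s0)/= (le_trans (ltW st)).
  - apply: derivable_within_continuous => s; rewrite in_itv/= => /andP[s0 st].
    have := hD s; rewrite s0 (le_trans st)// => /(_ isT) hs.
    exact: ex_derive.
  rewrite in_itv/= => /andP[c0 ct] hc.
  have dh0 : dh c * (t - 0) <= 0.
    rewrite subr0 mulr_le0_ge0 ?(ltW t0)// mulr_le0_ge0 ?expR_ge0// subr_le0.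
    by apply: dEC; [rewrite (ltW c0) (le_trans (ltW ct))|apply: Es; rewrite (ltW c0)].
  have : h t <= h 0 by rewrite -subr_le0 hc.
  by rewrite /h mulr0 expR0 mulr1 mulNr expRN ler_pdivrMr ?expR_gt0.
have below t : 0 <= t <= b -> E t < r.
  move=> tb; rewrite ltNge; apply/negP => rEt.
  pose A := [set s : R | 0 <= s <= b /\ r <= E s].
  have infA : has_inf A.
    by split; [exists t|exists 0 => s -[/andP[]]].
  pose m := inf A.
  have m0 : 0 <= m by apply: lb_le_inf; [exists t|move=> s [/andP[]]].
  have mb : m <= b.
    by apply: (@le_trans _ _ t); [apply: ge_inf => //; exact: infA.2|case/andP: tb].
  have Em : E m < r.
    apply: le_lt_trans Er; apply: le_trans (step m _ _) _.
    - by rewrite m0.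
    - move=> s /andP[s0 sm]; rewrite ltNge; apply/negP => rEs.
      suff : m <= s by rewrite leNgt sm.
      apply: ge_inf; first exact: infA.2.
      by split => //; rewrite s0 (le_trans (ltW sm)).
    - by rewrite ler_wpM2l// ler_expR ler_wpM2l.
  have /cvgr_lt/(_ _ Em) := cE m (introT andP (conj m0 mb)).
  move=> /nbhs_ballP[e /= e0 mE].
  have [s [sb rEs] sme] := inf_adherent e0 infA.
  have ms : m <= s by apply: ge_inf => //; exact: infA.2.
  have : E s < r.
    apply: mE; rewrite /ball/= ltr_norml; apply/andP; split; rewrite /m in sme ms *; lra.
  by rewrite ltNge rEs.
move=> t tb; apply: step => // s /andP[s0 st]; apply: below.
by rewrite s0 (le_trans (ltW st))//; case/andP: tb.
Qed.

End gronwall.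


Section lipschitz.
Context {R : realType} {d : nat}.
Implicit Types (F : 'rV[R]_d -> 'rV[R]_d) (x y p : 'rV[R]_d).

Definition locally_lipschitz F := forall p, exists2 k : R, 0 < k &
  forall x y, `|x - p| < k^-1 -> `|y - p| < k^-1 -> `|F x - F y| <= k * `|x - y|.

Lemma locally_lipschitzN F : locally_lipschitz F -> locally_lipschitz (\- F).
Proof.
move=> FL p; have [k k0 kF] := FL p; exists k => // x y xp yp.
by rewrite -opprD normrN; exact: kF.
Qed.

Lemma coord_le_norm x j : `|x ord0 j| <= `|x|.
Proof.
rewrite [leRHS]/Num.Def.normr/= mx_normrE.
exact: (le_bigmax _ (fun ij : 'I_1 * 'I_d => `|x ij.1 ij.2|) (ord0, j)).
Qed.

Lemma norm_le_coord x (c : R) : 0 <= c -> (forall j, `|x ord0 j| <= c) -> `|x| <= c.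
Proof.
move=> c0 xc; rewrite [leLHS]/Num.Def.normr/= mx_normrE bigmax_le// => -[i j] _.
by rewrite (ord1 i)/=.
Qed.

Lemma is_derive_coord (M : R -> 'rV[R]_d) (t v : R) dM j :
  is_derive t v M dM -> is_derive t v (fun s => M s ord0 j) (dM ord0 j).
Proof.
move=> [Mt <-]; split; first by move/derivable_mxP : (Mt); exact.
by rewrite derive_mx// mxE.
Qed.

(** The mean value theorem on segments, applied to each coordinate; the partial
    derivatives are bounded near p because they are continuous. *)
Lemma smooth_locally_lipschitz F : smooth F -> locally_lipschitz F.
Proof.
move=> /(_ 1%N)/= [dF cDF] p.
pose e k : 'rV[R]_d := delta_mx ord0 k.
pose M := \sum_k `|'D_(e k) F p| + 1.
have M0 : 0 < M by rewrite ltr_wpDl// sumr_ge0.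
have DFM : \forall q \near p, forall k, `|'D_(e k) F q| <= M.
  apply: (@filter_forall _ _ (fun (k : 'I_d) q => `|'D_(e k) F q| <= M) (nbhs p)) => k.
  have Mk : `|'D_(e k) F p| < M.
    by rewrite /M ltr_pwDr// (bigD1 k)//= lerDl sumr_ge0.
  have /(@cvgr_le _ _ (nbhs p)) : `|'D_(e k) F q| @[q --> p] --> `|'D_(e k) F p|.
    apply: (@cvg_norm _ _ _ (nbhs p)); exact: (cDF (e k) p).
  by apply.
have DvF q v : (forall k, `|'D_(e k) F q| <= M) -> `|'D_v F q| <= d%:R * M * `|v|.
  move=> qM; rewrite deriveE// [v in 'd F q v]row_sum_delta linear_sum/=.
  apply: le_trans (ler_norm_sum _ _ _) _.
  rewrite -mulrA mulr_natl -[X in _ *+ X]card_ord -sumr_const.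
  apply: ler_sum => k _; rewrite linearZ/= normrZ -deriveE// mulrC ler_pM//.
  exact: coord_le_norm.
move/nbhs_ballP : DFM => [r /= r0 rM].
exists (r^-1 + d%:R * M); first by rewrite ltr_pwDl ?invr_gt0// mulr_ge0// ltW.
have kr : (r^-1 + d%:R * M)^-1 <= r.
  by rewrite -[leRHS]invrK lef_pV2 ?posrE ?invr_gt0 ?lerDl ?ltr_pwDl ?mulr_ge0 ?invr_gt0// ltW.
move=> x y xp yp.
have ball_cvx s : 0 <= s <= 1 -> `|p - (s *: (x - y) + y)| < r.
  move=> /andP[s0 s1]; rewrite distrC.
  have -> : s *: (x - y) + y - p = s *: (x - p) + (1 - s) *: (y - p).
    by apply/rowP => j; rewrite !mxE; ring.
  apply: le_lt_trans (ler_normD _ _) _; rewrite !normrZ (ger0_norm s0).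
  rewrite ger0_norm ?subr_ge0//.
  have [xr yr] := (lt_le_trans xp kr, lt_le_trans yp kr).
  apply: (@le_lt_trans _ _ (Num.max `|x - p| `|y - p|)); last by rewrite gt_max xr.
  set m := Num.max _ _.
  have -> : m = s * m + (1 - s) * m by ring.
  rewrite lerD//.
    by rewrite ler_wpM2l// /m le_max lexx.
  by rewrite ler_wpM2l ?subr_ge0// /m le_max lexx orbT.
apply: norm_le_coord => [|j].
  by rewrite mulr_ge0// ltW// ltr_pwDl ?invr_gt0 ?mulr_ge0// ltW.
pose g (s : R) := F (s *: (x - y) + y) ord0 j.
have gD (s : R) : is_derive s 1 g ('D_(x - y) F (s *: (x - y) + y) ord0 j).
  apply: (is_derive_coord (M := fun s : R => F (s *: (x - y) + y))).
  have shE : (fun h : R => h^-1 *: (((fun s : R => F (s *: (x - y) + y)) \o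
      shift s) (h *: 1) - F (s *: (x - y) + y))) =
    (fun h : R => h^-1 *: ((F \o shift (s *: (x - y) + y)) (h *: (x - y)) -
      F (s *: (x - y) + y))).
    by apply/funext => h /=; rewrite -[h *: 1]/(h * 1) mulr1 scalerDl addrA.
  split; first by rewrite /derivable shE; exact: diff_derivable.
  by rewrite /derive shE.
have [|c] := @MVT_segment R g _ 0 1 ler01 (fun s _ => gD s).
  by apply: derivable_within_continuous => s _; exact: ex_derive.
rewrite in_itv/= => c01.
rewrite /g scale1r scale0r add0r subrK subr0 mulr1 => gE.
rewrite !mxE gE; apply: le_trans (coord_le_norm _ _) _.
apply: le_trans (DvF _ _ _) _; first by move=> k; apply: rM; rewrite -ball_normE; exact: ball_cvx.
by rewrite ler_wpM2r// lerDr invr_ge0 ltW.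
Qed.

End lipschitz.


(** * Stability of trajectories *)

Section trajectories.
Context {R : realType} {d : nat}.
Implicit Types (F : 'rV[R]_d -> 'rV[R]_d) (x y : 'rV[R]_d) (c w : R -> 'rV[R]_d).

(** The derivatives at both ends are two-sided: the trajectories considered extend
    beyond [0, b]. *)
Definition trajectory F (b : R) c :=
  forall t : R, 0 <= t <= b -> is_derive t 1 c (F (c t)).

(** The sup norm is not differentiable, so distances between trajectories are
    differentiated through the squared Euclidean distance. *)
Definition sqdist x y : R := \sum_j (x ord0 j - y ord0 j) ^+ 2.

Lemma sqdist_ge0 x y : 0 <= sqdist x y.
Proof. by apply: sumr_ge0 => j _; exact: sqr_ge0. Qed.

Lemma norm_le_sqdist x y : `|x - y| ^+ 2 <= sqdist x y.
Proof.
rewrite -[leRHS]sqr_sqrtr ?sqdist_ge0// ler_sqr ?nnegrE ?sqrtr_ge0//.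
apply: norm_le_coord => [|j]; first exact: sqrtr_ge0.
rewrite -sqrtr_sqr ler_wsqrtr// !mxE /sqdist (bigD1 j)//= lerDl.
by apply: sumr_ge0 => i _; exact: sqr_ge0.
Qed.

Lemma sqdist_le_norm x y : sqdist x y <= d%:R * `|x - y| ^+ 2.
Proof.
rewrite mulr_natl -[X in _ *+ X]card_ord -sumr_const; apply: ler_sum => j _.
rewrite -[leLHS]real_normK ?num_real// ler_sqr ?nnegrE//.
by have := coord_le_norm (x - y) j; rewrite !mxE.
Qed.

Lemma trajectory_continuous F b c t :
  trajectory F b c -> 0 <= t <= b -> {for t, continuous c}.
Proof.
move=> cF /cF ct; apply: differentiable_continuous.
exact/derivable1_diffP/(@ex_derive _ _ _ _ _ _ _ ct).
Qed.

(** By compactness of [0, b], one constant L serves both as a Lipschitz constant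
    and, through its inverse, as the width of a tube around the trajectory. *)
Lemma lipschitz_tube F b c : locally_lipschitz F -> trajectory F b c ->
  exists2 L : R, 0 < L & forall t q, 0 <= t <= b -> `|q - c t| < L^-1 ->
    `|F q - F (c t)| <= L * `|q - c t|.
Proof.
move=> FL cF.
have cov : \forall L \near +oo, `[0, b] `<=` (fun t => forall q,
    `|q - c t| < L^-1 -> `|F q - F (c t)| <= L * `|q - c t|).
  apply: (compact_near_coveringP _).1; first exact: segment_compact.
  move=> t0 /=; rewrite in_itv/= => t0b; have [k k0 kF] := FL (c t0).
  have k20 : 0 < (2 * k)^-1 by rewrite invr_gt0 mulr_gt0.
  near=> t L => q qt.
  have L2k : 2 * k <= L by near: L; apply: nbhs_pinfty_ge; rewrite num_real.
  have kL : L^-1 <= (2 * k)^-1 by rewrite lef_pV2 ?posrE ?(lt_le_trans _ L2k) ?mulr_gt0.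
  have k2 : k^-1 = (2 * k)^-1 + (2 * k)^-1 by field; rewrite gt_eqF.
  have tt0 : `|c t - c t0| < (2 * k)^-1.
    near: t; apply: (@cvgr_distC_lt _ _ _ (nbhs t0) _ c (c t0)) => //.
    exact: (trajectory_continuous cF).
  apply: le_trans (kF q (c t) _ _) _.
  - rewrite k2 -(subrKA (c t)) (le_lt_trans (ler_normD _ _))// ltrD//.
    exact: lt_le_trans kL.
  - by rewrite k2 (lt_trans tt0)// ltrDl.
  - by rewrite ler_wpM2r// (le_trans _ L2k)// ler_peMl// ?ltW// ltr1n.
have : \forall L \near +oo, 0 < (L : R) by apply: nbhs_pinfty_gt; rewrite num_real.
move=> /(filterI cov)/filter_ex[L [LP L0]]; exists L => // t q tb.
by apply: LP; rewrite /= in_itv.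
Unshelve. all: by end_near. Qed.

(** Applied to F it gives uniqueness and continuous dependence forward in time;
    applied to - F it gives them backward.  The second trajectory may live on a
    shorter interval, so that the estimate can also serve to bound lifetimes. *)
Lemma trajectory_close F b c (e : R) : locally_lipschitz F ->
  trajectory F b c -> 0 <= b -> 0 < e ->
  exists2 r : R, 0 < r & forall b' w, b' <= b -> trajectory F b' w ->
    `|w 0 - c 0| < r -> forall t, 0 <= t <= b' -> `|w t - c t| < e.
Proof.
move=> FL cF b0 e0; have [L L0 FcL] := lipschitz_tube FL cF.
pose m := Num.min (L^-1 ^+ 2) (e ^+ 2).
have m0 : 0 < m by rewrite lt_min !exprn_gt0// invr_gt0.
pose C := 2 * d%:R * L.
have C0 : 0 <= C by rewrite !mulr_ge0// ltW.
pose K := d%:R * expR (C * b).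
have K0 : 0 <= K by rewrite mulr_ge0// expR_ge0.
pose r := Num.min 1 (m / (K + 1)).
have r0 : 0 < r by rewrite lt_min ltr01/= divr_gt0// ltr_wpDl.
exists r => // b' w b'b wF wr.
have Er : sqdist (w 0) (c 0) * expR (C * b) < m.
  have : K * r < m.
    apply: (@le_lt_trans _ _ (K * (m / (K + 1)))).
      by rewrite ler_wpM2l// ge_min lexx orbT.
    by rewrite mulrCA -ltr_pdivlMl// mulVf ?gt_eqF// ltr_pdivrMr ?ltr_wpDl// mul1r ltrDl.
  apply: le_lt_trans; rewrite /K [leRHS]mulrAC ler_wpM2r ?expR_ge0//.
  apply: le_trans (sqdist_le_norm _ _) _; rewrite ler_wpM2l//.
  rewrite expr2 -[leRHS]mulr1 ler_pM//; first exact: ltW.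
  by rewrite (le_trans (ltW wr))// ge_min lexx.
have small t : sqdist (w t) (c t) < m -> `|w t - c t| < L^-1 /\ `|w t - c t| < e.
  move=> Em; have := le_lt_trans (norm_le_sqdist _ _) Em.
  rewrite lt_min => /andP[].
  by rewrite !ltr_sqr ?nnegrE// ?invr_ge0 ltW.
pose E t := sqdist (w t) (c t).
pose dE t := \sum_j 2 * (w t ord0 j - c t ord0 j) *
  (F (w t) ord0 j - F (c t) ord0 j).
have EE t : 0 <= t <= b' -> E t <= E 0 * expR (C * t).
  apply: (@gronwall_barrier R E dE C m b') => //.
  - exact: sqdist_ge0.
  - move=> {}t tb.
    have -> : E = \sum_(j < d) (fun s => (w s ord0 j - c s ord0 j) ^+ 2).
      by apply/funext => s; rewrite fct_sumE.
    apply: is_derive_sum => j.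
    have wt := is_derive_coord j (wF t tb).
    have ct : is_derive t 1 (fun s => c s ord0 j) (F (c t) ord0 j).
      apply: is_derive_coord; apply: cF; case/andP: tb => -> tb'.
      exact: le_trans b'b.
    apply: is_derive_eq.
    rewrite -[X in X + X]/((w t ord0 j - c t ord0 j) * (F (w t) ord0 j - F (c t) ord0 j)).
    ring.
  - move=> {}t tb /small[wcL _].
    have {}wcL : `|F (w t) - F (c t)| <= L * `|w t - c t|.
      by apply: FcL => //; case/andP: tb => ->/= /le_trans; apply.
    have -> : C * E t = \sum_(j < d) 2 * L * E t.
      by rewrite sumr_const card_ord -[RHS]mulr_natl /C; ring.
    apply: ler_sum => j _; rewrite -!mulrA ler_wpM2l//.
    have := norm_le_sqdist (w t) (c t); rewrite -/(E t).
    have := coord_le_norm (w t - c t) j; have := coord_le_norm (F (w t) - F (c t)) j.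
    rewrite !mxE; set a := w t _ _ - _; set f := F _ _ _ - _; set n := `|w t - c t| in wcL *.
    move=> /le_trans/(_ wcL) fn an nE.
    apply: (@le_trans _ _ (L * n ^+ 2)); last by rewrite ler_wpM2l// ltW.
    apply: le_trans (ler_norm _) _; rewrite normrM expr2 mulrCA.
    by rewrite ler_pM.
  - apply: le_lt_trans Er; rewrite ler_wpM2l ?sqdist_ge0// ler_expR ler_wpM2l//.
move=> t /[dup] tb /EE Et; apply: (small t _).2.
apply: le_lt_trans Er; apply: le_trans Et _.
rewrite ler_wpM2l ?sqdist_ge0// ler_expR ler_wpM2l//.
by case/andP: tb => _ /le_trans; apply.
Qed.

End trajectories.


(** * The flow of a forward complete vector field *)

Section affine_change.
Context {R : realType} {V : normedModType R}.

(** The difference quotient of c (a * r + b) in the direction 1 is literally that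
    of c in the direction a. *)
Lemma is_derive_affine (c : R -> V) (a b t : R) dc :
  is_derive (a * t + b) 1 c dc ->
  is_derive t 1 (fun r => c (a * r + b)) (a *: dc).
Proof.
move=> cP; have dcP : differentiable c (a * t + b).
  exact/derivable1_diffP/(@ex_derive _ _ _ _ _ _ _ cP).
have shE : (fun h : R => h^-1 *: (((fun r : R => c (a * r + b)) \o
    shift t) (h *: 1) - c (a * t + b))) =
  (fun h : R => h^-1 *: ((c \o shift (a * t + b)) (h *: a) - c (a * t + b))).
  apply/funext => h /=; rewrite -[h *: 1]/(h * 1) -[h *: a]/(h * a).
  by congr (_ *: (c _ - _)); ring.
split; first by rewrite /derivable shE; exact: diff_derivable.
rewrite /derive shE -[LHS]/('D_a c (a * t + b)) deriveE//.
have <- : 'd c (a * t + b) 1 = dc by case: cP => _ <-; rewrite (deriveE _ dcP).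
by rewrite -linearZ/=; congr ('d _ _ _); rewrite /GRing.scale/= mulr1.
Qed.

End affine_change.

Section flow.
Context {R : realType} {d : nat}.
Variables (F : 'rV[R]_d -> 'rV[R]_d) (phi : R -> 'rV[R]_d -> 'rV[R]_d)
  (s : 'rV[R]_d -> \bar R).
Hypothesis (F_lip : locally_lipschitz F) (phiP : forward_complete_flow F phi s).
Implicit Types (x p : 'rV[R]_d) (t r a b : R).

Lemma life_gt0 x : (0 < s x)%E. Proof. by have [] := phiP x. Qed.

Lemma flow0 x : phi 0 x = x. Proof. by have [] := phiP x. Qed.

Lemma flow_is_derive x t : (- s x < t%:E)%E ->
  is_derive t 1 (phi ^~ x) (F (phi t x)).
Proof. by have [_ _ + _] := phiP x => /(_ t) + st; apply; rewrite st ltry. Qed.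

Lemma flow_continuous x t : (- s x < t%:E)%E -> {for t, continuous (phi ^~ x)}.
Proof.
move=> /flow_is_derive xt; apply: differentiable_continuous.
exact/derivable1_diffP/(@ex_derive _ _ _ _ _ _ _ xt).
Qed.

Lemma life_lt0 x t : 0 <= t -> (- s x < t%:E)%E.
Proof.
by move=> t0; apply: lt_le_trans (_ : (0 <= _)%E); rewrite ?lee_fin// oppe_lt0 life_gt0.
Qed.

Lemma trajectory_shift x t b : (- s x < t%:E)%E ->
  trajectory F b (fun r => phi (r + t) x).
Proof.
move=> xt r /andP[r0 _].
have : is_derive (1 * r + t) 1 (phi ^~ x) (F (phi (r + t) x)).
  rewrite mul1r; apply: flow_is_derive; apply: lt_le_trans xt _.
  by rewrite lee_fin lerDr.
move=> /is_derive_affine; rewrite scale1r.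
by under eq_fun do rewrite mul1r.
Qed.

Lemma trajectory_backward x t b : (b%:E < s x + t%:E)%E ->
  trajectory (\- F) b (fun r => phi (t - r) x).
Proof.
move=> xt r /andP[r0 rb].
have : is_derive (-1 * r + t) 1 (phi ^~ x) (F (phi (t - r) x)).
  rewrite mulN1r addrC; apply: flow_is_derive.
  move: (s x) (life_gt0 x) xt => [l| |]//= _; last by move=> *; rewrite ltNyr.
  by rewrite -?EFinD !lte_fin; lra.
move=> /is_derive_affine; rewrite scaleN1r.
by under eq_fun do rewrite mulN1r addrC.
Qed.

Lemma trajectory_unique G b (c w : R -> 'rV[R]_d) : locally_lipschitz G ->
  trajectory G b c -> trajectory G b w -> w 0 = c 0 ->
  forall t, 0 <= t <= b -> w t = c t.
Proof.
move=> GL cG wG wc0 t /[dup] tb /andP[t0 tb'].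
apply/eqP; rewrite -subr_eq0 -normr_eq0 eq_le normr_ge0 andbT.
apply/ler_addgt0Pl => e e0; rewrite addr0.
have [r r0 /(_ b w)] := trajectory_close GL cG (le_trans t0 tb') e0.
by rewrite lexx wc0 subrr normr0 => /(_ isT wG r0 t tb)/ltW.
Qed.

(** The time shift of the trajectory of x is a solution through phi t x, so the
    maximal one lives at least as long. *)
Lemma life_shift x t : (- s x < t%:E)%E -> (s x + t%:E <= s (phi t x))%E.
Proof.
move=> xt; have [_ _ _ /(_ (- (s x + t%:E))%E +oo%E (fun r => phi (r + t) x))] :=
  phiP (phi t x).
rewrite leeN2; apply.
- rewrite ltry andbT; move: (s x) (life_gt0 x) xt => [l| |]//= _.
  by rewrite -?EFinD !lte_fin; lra.
- by rewrite add0r.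
- move=> r /andP[xr _].
  have : is_derive (1 * r + t) 1 (phi ^~ x) (F (phi (r + t) x)).
    rewrite mul1r; apply: flow_is_derive.
    move: (s x) (life_gt0 x) xr => [l| |]//= _; last by move=> *; rewrite ltNyr.
    by rewrite -?EFinD !lte_fin; lra.
  move=> /is_derive_affine; rewrite scale1r.
  by under eq_fun do rewrite mul1r.
Qed.

Lemma flow_add x t r : (- s x < t%:E)%E -> (- s x < (r + t)%:E)%E ->
  phi r (phi t x) = phi (r + t) x.
Proof.
move=> xt xrt; have [r0|r0] := leP 0 r.
  apply: (@trajectory_unique F r (fun q => phi (q + t) x) (phi ^~ (phi t x))) => //.
  - exact: trajectory_shift.
  - have := @trajectory_shift (phi t x) 0 r (life_lt0 _ (lexx 0)).
    by under eq_fun do rewrite addr0.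
  - by rewrite flow0 add0r.
  - by rewrite r0 lexx.
have -> : r + t = t - - r by ring.
rewrite (_ : phi r = phi (0 - - r)); last by congr phi; ring.
apply: (@trajectory_unique (\- F) (- r) (fun q => phi (t - q) x)
  (fun q => phi (0 - q) (phi t x))).
- exact: locally_lipschitzN.
- apply: trajectory_backward.
  move: (s x) (life_gt0 x) xrt => [l| |]//= _; last by move=> *; rewrite ltry.
  by rewrite -?EFinD !lte_fin; lra.
- apply: trajectory_backward; rewrite adde0.
  apply: lt_le_trans (life_shift xt).
  move: (s x) (life_gt0 x) xrt => [l| |]//= _; last by move=> *; rewrite ltry.
  by rewrite -?EFinD !lte_fin; lra.
- by rewrite !subr0 flow0.
- by rewrite oppr_ge0 (ltW r0) lexx.
Qed.

Lemma flow_forward_close x b (e : R) : 0 <= b -> 0 < e ->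
  exists2 r : R, 0 < r & forall x', `|x' - x| < r ->
    forall t, 0 <= t <= b -> `|phi t x' - phi t x| < e.
Proof.
move=> b0 e0.
have traj x' : trajectory F b (phi ^~ x').
  have := @trajectory_shift x' 0 b (life_lt0 _ (lexx 0)).
  by under eq_fun do rewrite addr0.
have [r r0 rP] := trajectory_close F_lip (traj x) b0 e0.
by exists r => // x' x'x; apply: rP (lexx b) (traj x') _; rewrite !flow0.
Qed.

Lemma flow_backward_close x a (e : R) : 0 <= a -> (a%:E < s x)%E -> 0 < e ->
  exists2 r : R, 0 < r & forall x', `|x' - x| < r ->
    forall t, (t%:E < s x')%E -> 0 <= t <= a -> `|phi (- t) x' - phi (- t) x| < e.
Proof.
move=> a0 ax e0.
have traj x' b : (b%:E < s x')%E -> trajectory (\- F) b (fun t => phi (- t) x').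
  move=> bx'; have := @trajectory_backward x' 0 b; rewrite adde0 => /(_ bx').
  by under eq_fun do rewrite sub0r.
have [r r0 rP] := trajectory_close (locally_lipschitzN F_lip) (traj _ _ ax) a0 e0.
exists r => // x' x'x t tx' /andP[t0 ta].
apply: rP ta (traj x' _ tx') _ _ _; first by rewrite oppr0 !flow0.
by rewrite t0 lexx.
Qed.

(** If s x' <= a for some x' near x, the backward trajectory of x' stays close to
    that of x, hence in a compact set, up to time l := s x'.  For a cluster point p
    at that time, forward continuity and the flow property give
    phi t p = phi (t - l) x' for t > 0.  The solution t |-> phi (t + l) p then passes
    through x' at time 0 and starts before - l, against maximality. *)
Lemma life_lower_semicontinuous x a : (a%:E < s x)%E ->
  \forall x' \near x, (a%:E < s x')%E.
Proof.
wlog a0 : a / 0 <= a => [hwlog ax|].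
  have := hwlog (Num.max a 0); rewrite le_max lexx orbT => /(_ isT).
  rewrite EFin_max gt_max ax life_gt0 => /(_ isT); apply: filterS => x'.
  by rewrite gt_max => /andP[].
move=> ax.
have [r r0 rP] := flow_backward_close a0 ax ltr01.
apply/nbhs_ballP; exists r => //= x'; rewrite -ball_normE /= distrC => x'x.
rewrite ltNge; apply/negP => x'a.
(* l is the lifetime of x', finite since it is at most a *)
have [l sl] : exists l, s x' = l%:E.
  by move: (s x') (life_gt0 x') x'a => [l| |]//= _ _; exists l.
have l0 : 0 < l by have := life_gt0 x'; rewrite sl lte_fin.
have la : l <= a by rewrite -lee_fin -sl.
have back_x t : 0 <= t <= a -> {for t, continuous (fun t => phi (- t) x)}.
  have := @trajectory_backward x 0 a; rewrite adde0 => /(_ ax).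
  under eq_fun do rewrite sub0r.
  by move=> tr; exact: trajectory_continuous tr.
have [M MP] : exists M, forall t, 0 <= t <= a -> `|phi (- t) x| <= M.
  have : compact ((fun t => phi (- t) x) @` `[0, a]).
    apply: continuous_compact; last exact: segment_compact.
    apply: continuous_in_subspaceT => t; rewrite inE/= in_itv/=; exact: back_x.
  move=> /compact_bounded[M [_ MP]]; exists (M + 1) => t ta.
  by apply: (MP (M + 1)); [rewrite ltrDl|exists t; rewrite //= in_itv].
pose A := [set v : 'rV[R]_d | `|v| <= M + 1].
have cA : compact A.
  apply: bounded_closed_compact.
    exists (M + 1); split; first by rewrite num_real.
    by move=> N MN v /= vA; apply: le_trans (ltW MN).
  apply: (preimage_closed _ (@closed_le R (M + 1))) => v _.
  exact: norm_continuous.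
pose G := (fun t => phi (- t) x') @ l^'-.
have GA : \forall t \near l^'-, A (phi (- t) x').
  near=> t; rewrite /A /=.
  have t0 : 0 <= t by near: t; apply: nbhs_left_ge.
  have tl : t < l by near: t; apply: nbhs_left_lt.
  have ta : 0 <= t <= a by rewrite t0 (le_trans (ltW tl)).
  rewrite -(subrK (phi (- t) x) (phi _ x')) addrC (le_trans (ler_normD _ _))// lerD ?MP//.
  by rewrite ltW// rP// sl lte_fin.
have [p [_ Gp]] : A `&` cluster G !=set0 by apply: cA => //; exact: fmap_proper_filter.
have phip t : 0 < t -> phi t p = phi (t - l) x'.
  move=> t0; apply/eqP; rewrite -subr_eq0 -normr_eq0 eq_le normr_ge0 andbT.
  apply/ler_addgt0Pl => e e0; rewrite addr0.
  have e20 : 0 < e / 2 by rewrite divr_gt0.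
  have [r' r'0 r'P] := flow_forward_close p (ltW t0) e20.
  have Gt : \forall u \near l^'-, `|phi t (phi (- u) x') - phi (t - l) x'| < e / 2.
    have cx' : {for l, continuous (fun u => phi (t - u) x')}.
      have := @trajectory_backward x' t l.
      move=> /(_ _)/trajectory_continuous; apply; first by rewrite sl -EFinD lte_fin ltrDl.
      by rewrite (ltW l0) lexx.
    near=> u; rewrite /=.
    have ul : u < l by near: u; apply: nbhs_left_lt.
    rewrite flow_add ?sl ?lte_fin; [|lra|lra].
    near: u.
    have cl : phi (t - u) x' @[u --> l^'-] --> phi (t - l) x'.
      exact: (@cvg_at_left_filter _ _ (fun u => phi (t - u) x')).
    exact: (@cvgr_distC_lt _ _ _ l^'- _ (fun u => phi (t - u) x') _ cl).
  have [q [qt]] := Gp [set q | `|phi t q - phi (t - l) x'| < e / 2] _ Gt (nbhsx_ballx p _ r'0).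
  rewrite -ball_normE /= distrC => qp.
  rewrite -(subrKA (phi t q)) (le_trans (ler_normD _ _))//.
  rewrite (splitr e) lerD//; last exact: ltW.
  by rewrite distrC ltW// r'P// (ltW t0) lexx.
have [_ _ _ /(_ (- (s p + l%:E))%E +oo%E (fun t => phi (t + l) p))] := phiP x'.
have p0 := life_gt0 p.
have H : (- (s p + l%:E) < (0 : \bar R) < (+oo : \bar R))%E.
  by rewrite lt0y andbT oppe_lt0 adde_gt0// lte_fin.
rewrite H add0r phip// subrr flow0 => /(_ isT erefl).
have K : solves_on F (- (s p + l%:E)) +oo (fun t => phi (t + l) p).
  move=> t /andP[pt _].
  have : is_derive (1 * t + l) 1 (phi ^~ p) (F (phi (t + l) p)).
    rewrite mul1r; apply: flow_is_derive.
    move: (s p) p0 pt => [u| |]//= _; last by move=> *; rewrite ltNyr.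
    by rewrite -?EFinD !lte_fin; lra.
  move=> /is_derive_affine; rewrite scale1r.
  by under eq_fun do rewrite mul1r.
move=> /(_ K); rewrite leeN2 sl leNgt.
by move: (s p) p0 => [u| |]//=; rewrite ?ltry// -?EFinD !lte_fin ltrDr => ->.
Unshelve. all: by end_near. Qed.

Lemma flow_cvg {T : Type} {FF : set_system T} {FFF : Filter FF}
    (f : T -> 'rV[R]_d) (g : T -> R) x t :
  (- s x < t%:E)%E -> f @ FF --> x -> g @ FF --> t ->
  phi (g u) (f u) @[u --> FF] --> phi t x.
Proof.
move=> xt fx gt.
have [a [a0 ta ax]] : exists a, [/\ 0 <= a, - a < t & (a%:E < s x)%E].
  move: (s x) (life_gt0 x) xt => [l| |]//=; last first.
    by move=> *; exists (`|t| + 1); rewrite addr_ge0// ltry ltrNl ltr_pwDr// ler_normr lexx orbT.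
  rewrite !lte_fin => l0 lt.
  exists ((Num.max 0 (- t) + l) / 2).
  by have [t0|t0] := leP 0 (- t); rewrite lte_fin; split; lra.
apply/cvgrPdist_lt => e e0; have e20 : 0 < e / 2 by rewrite divr_gt0.
have [r1 r10 r1P] := flow_forward_close x (ler_wpDl ler01 (normr_ge0 t)) e20.
have [r2 r20 r2P] := flow_backward_close a0 ax e20.
near=> u.
rewrite -(subrKA (phi (g u) x)) (splitr e) (le_lt_trans (ler_normD _ _))// ltrD//.
  near: u; have cp : phi (g u) x @[u --> FF] --> phi t x.
    exact: (cvg_comp _ _ gt (flow_continuous xt)).
  exact: (@cvgr_dist_lt _ _ _ FF _ (fun u => phi (g u) x) _ cp).
have fu : `|f u - x| < Num.min r1 r2.
  by near: u; apply: (@cvgr_distC_lt _ _ _ FF _ f _ fx); rewrite lt_min r10.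
move: fu; rewrite lt_min => /andP[fu1 fu2].
rewrite distrC; have [gu0|gu0] := leP 0 (g u).
  apply: r1P => //; rewrite gu0/=; near: u; apply: (@cvgr_le _ _ FF _ g t gt).
  by rewrite (le_lt_trans (ler_norm _))// ltrDr.
rewrite -[g u]opprK; apply: r2P => //.
  apply: (@le_lt_trans _ _ a%:E).
    rewrite lee_fin lerNl; near: u; exact: (@cvgr_ge _ _ FF _ g t gt).
  by near: u; apply: (fx _ (life_lower_semicontinuous ax)).
rewrite oppr_ge0 (ltW gu0) lerNl/=; near: u; exact: (@cvgr_ge _ _ FF _ g t gt).
Unshelve. all: by end_near. Qed.

End flow.

(** * Survival functions and hazards *)

Section survival.
Context {R : realType} {d N : nat} (D : switching R d N) (i : 'I_N).
Implicit Types t h : R.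

Lemma survivalE t : (G D i t)%:E = mu D i `]t, +oo[%classic.
Proof. by rewrite /G fineK// fin_num_measure. Qed.

Lemma survival_ge0 t : 0 <= G D i t. Proof. by rewrite -lee_fin survivalE. Qed.

Lemma survival_le1 t : G D i t <= 1.
Proof. by rewrite -lee_fin survivalE; exact: probability_le1. Qed.

Lemma survival_nonincreasing t h : t <= h -> G D i h <= G D i t.
Proof.
move=> th; rewrite -lee_fin !survivalE le_measure ?inE//.
by apply: subset_itv; rewrite bnd_simp.
Qed.

Lemma survival0 : G D i 0 = 1.
Proof.
apply/eqP; rewrite -eqe survivalE; apply/eqP.
rewrite -[RHS](mu_nneg D i) -(@setU1itv _ _ _ _ false) ?bnd_simp// measureU//.
  by rewrite [X in (X + _)%E](mu_at0 D i) add0e.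
by rewrite -subset0 => x [/= ->]; rewrite in_itv/= ltxx.
Qed.

Let idTR : measurableTypeR R -> R := idfun.

#[local] HB.instance Definition _ :=
  @isMeasurableFun.Build _ _ _ _ idTR (@measurable_id _ _ setT).

Let ccdfE t : ccdf (idTR : {RV (mu D i) >-> R}) t = (G D i t)%:E.
Proof. by rewrite survivalE /ccdf /distribution /pushforward /= preimage_id. Qed.

Lemma survival_right_continuous t : G D i h @[h --> t^'+] --> G D i t.
Proof.
have := @ccdf_right_continuous _ _ _ _ (idTR : {RV (mu D i) >-> R}) t.
by rewrite ccdfE (eq_cvg _ _ ccdfE) => /fine_cvg.
Qed.

Lemma survival_cvgy : G D i h @[h --> +oo] --> 0.
Proof.
have := @cvg_ccdfy0 _ _ _ _ (idTR : {RV (mu D i) >-> R}).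
by rewrite (eq_cvg _ _ ccdfE) => /fine_cvg.
Qed.

(** Positivity at h makes the inequality strict because G is right-continuous, hence
    still positive slightly after h. *)
Lemma survival_gt0 h : 0 <= h -> (h%:E < tbar D i)%E <-> 0 < G D i h.
Proof.
move=> h0; split=> [htbar|Gh].
  rewrite lt_neqAle survival_ge0 andbT eq_sym; apply/eqP => Gh.
  move: htbar; rewrite ltNge => /negP; apply.
  by apply: ereal_inf_lbound; exists h.
have [u [hu uG]] : exists u, h < u /\ 0 < G D i u.
  move/cvgr_gt : (@survival_right_continuous h) => /(_ _ Gh).
  by move=> /(filterI (nbhs_right_gt h))/filter_ex[u [hu uG]]; exists u.
apply: (@lt_le_trans _ _ u%:E); first by rewrite lte_fin.
apply: le_ereal_inf_tmp => _ [t [t0 Gt] <-]; rewrite lee_fin leNgt; apply/negP => tu.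
by move: uG; rewrite ltNge -Gt survival_nonincreasing// ltW.
Qed.

End survival.

Section rates.
Context {R : realType} {d N : nat} (D : switching R d N).

Lemma lambda_lower : exists2 c : R, 0 < c & forall i x, c <= lambda D i x.
Proof.
have := lambda_inf D; set m := ereal_inf _ => m0.
have mP i x : (m <= (lambda D i x)%:E)%E.
  by apply: ereal_inf_lbound; exists i => //; exists x.
move: m m0 mP => [c| |]//; first by rewrite lte_fin => c0 cP; exists c.
by move=> _ mP; exists 1 => // i x; have := mP i x; rewrite leye_eq.
Qed.

Lemma lambda_upper : exists2 L : R, 0 < L & forall i x, lambda D i x <= L.
Proof.
have := lambda_sup D; set m := ereal_sup _ => m0.
have mP i x : ((lambda D i x)%:E <= m)%E.
  by apply: ereal_sup_ubound; exists i => //; exists x.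
move: m m0 mP => [c| |]//.
  move=> _ cP; exists (Num.max 1 c); first by rewrite lt_max ltr01.
  by move=> i x; rewrite le_max -[X in _ || X]lee_fin cP orbT.
by move=> _ mP; exists 1 => // i x; have := mP i x; rewrite leeNy_eq.
Qed.

End rates.

Section hazard.
Context {R : realType} {d N : nat} (D : switching R d N) (i : 'I_N).
Implicit Types (x : 'rV[R]_d) (s t r : R).

Let F_lip := smooth_locally_lipschitz (F_smooth D i).
Let leb := @lebesgue_measure R.

Definition rate x r : R := lambda D i (phi D i r x).

Lemma rate_cvg {T : Type} {FF : set_system T} {FFF : Filter FF}
    (f : T -> 'rV[R]_d) (g : T -> R) x t :
  (- life D i x < t%:E)%E -> f @ FF --> x -> g @ FF --> t ->
  rate (f u) (g u) @[u --> FF] --> rate x t.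
Proof.
move=> xt fx gt.
exact: cvg_comp (flow_cvg F_lip (phi_flow D i) xt fx gt) (@lambda_continuous _ _ _ D i _).
Qed.

Lemma rate_continuous x s t : (s%:E < life D i x)%E ->
  {within `[- s, t], continuous rate x}.
Proof.
move=> sx; apply: continuous_in_subspaceT => r; rewrite inE/= in_itv/= => /andP[sr _].
apply: rate_cvg; [|exact: cvg_cst|exact: cvg_id].
by rewrite lteNl (le_lt_trans _ sx)// lee_fin lerNl.
Qed.

Lemma rate_integrable x s t : (s%:E < life D i x)%E ->
  leb.-integrable `[- s, t] (EFin \o rate x).
Proof.
move=> sx; apply: continuous_compact_integrable; first exact: segment_compact.
exact: rate_continuous.
Qed.

Lemma rate_measurable x s t : (s%:E < life D i x)%E ->
  measurable_fun `[- s, t] (rate x).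
Proof.
move=> sx; apply/measurable_EFinP.
by have /integrableP[] := rate_integrable t sx.
Qed.

Lemma hazardE x s t : hazard D i x s t = \int[leb]_(r in `[- s, t]) rate x r.
Proof. by []. Qed.

Lemma hazard_ge0 x s t : 0 <= hazard D i x s t.
Proof. by apply: Rintegral_ge0 => r _; exact: lambda_ge0. Qed.

Lemma itv_measure s t : - s <= t -> fine (leb `[- s, t]%classic) = s + t.
Proof.
move=> st; rewrite /leb lebesgue_measure_itv/= lte_fin.
by case: ltgtP st => [|//|<-]//= _; rewrite ?opprK 1?addrC// ?subrr // addNr.
Qed.

Lemma cst_integrable s t c : leb.-integrable `[- s, t] (EFin \o cst c).
Proof.
apply: continuous_compact_integrable; first exact: segment_compact.
by apply: continuous_subspaceT => r; exact: cvg_cst.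
Qed.

Lemma hazard_lower c x s t : (forall x', c <= lambda D i x') ->
  (s%:E < life D i x)%E -> - s <= t -> c * (s + t) <= hazard D i x s t.
Proof.
move=> cP sx st; rewrite -(itv_measure st) -Rintegral_cst//.
apply: le_Rintegral => //; first exact: cst_integrable.
exact: rate_integrable.
Qed.

Lemma hazard_upper c x s t : (forall x', lambda D i x' <= c) ->
  (s%:E < life D i x)%E -> - s <= t -> hazard D i x s t <= c * (s + t).
Proof.
move=> cP sx st; rewrite -(itv_measure st) -Rintegral_cst//.
apply: le_Rintegral => //; last exact: cst_integrable.
exact: rate_integrable.
Qed.

Lemma hazard_nondecreasing x s t t' : (s%:E < life D i x)%E -> t <= t' ->
  hazard D i x s t <= hazard D i x s t'.
Proof.
move=> sx tt'; apply: fine_le.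
- by apply: integrable_fin_num => //; exact: rate_integrable.
- by apply: integrable_fin_num => //; exact: rate_integrable.
apply: ge0_subset_integral => //.
- by apply/measurable_EFinP; exact: rate_measurable.
- by move=> r _; rewrite lee_fin lambda_ge0.
- by apply: subset_itvl; rewrite bnd_simp.
Qed.

(** Dominated convergence on a fixed interval [- A, A] that contains all the
    domains of integration; the indicators of these domains converge except at the
    two end points of the limit domain. *)
Lemma hazard_cvg (x_ : nat -> 'rV[R]_d) (s_ t_ : nat -> R) x s t :
  (forall n, ((s_ n)%:E < life D i (x_ n))%E) -> (s%:E < life D i x)%E ->
  x_ @ \oo --> x -> s_ @ \oo --> s -> t_ @ \oo --> t ->
  hazard D i (x_ n) (s_ n) (t_ n) @[n --> \oo] --> hazard D i x s t.
Proof.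
move=> lx_ lx xx ss tt.
have [L L0 LP] := lambda_upper D.
have [M1 M10 M1P] : exists2 M : R, M > 0 & forall n, `|s_ n| <= M.
  have /cvg_seq_bounded/pinfty_ex_gt0[M M0 MP] : cvgn s_ by apply/cvg_ex; exists s.
  by exists M => // n; exact: MP.
have [M2 M20 M2P] : exists2 M : R, M > 0 & forall n, `|t_ n| <= M.
  have /cvg_seq_bounded/pinfty_ex_gt0[M M0 MP] : cvgn t_ by apply/cvg_ex; exists t.
  by exists M => // n; exact: MP.
pose A := M1 + M2 + `|s| + `|t|.
have sA n : `|s_ n| <= A by have := M1P n; rewrite /A; have := normr_ge0 s; have := normr_ge0 t; lra.
have tA n : `|t_ n| <= A by have := M2P n; rewrite /A; have := normr_ge0 s; have := normr_ge0 t; lra.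
have lsA : `|s| <= A by rewrite /A; have := normr_ge0 t; lra.
have ltA : `|t| <= A by rewrite /A; have := normr_ge0 s; lra.
pose I a b := `[- a, b]%classic : set R.
pose g n := (EFin \o rate (x_ n)) \_ (I (s_ n) (t_ n)).
pose g0 := (EFin \o rate x) \_ (I s t).
have IE a b (f : R -> \bar R) : `|a| <= A -> `|b| <= A ->
    (\int[leb]_(r in I a b) f r = \int[leb]_(r in I A A) (f \_ (I a b)) r)%E.
  move=> aA bA; rewrite -integral_mkcondr; congr integral; apply/esym/setIidPr.
  by apply: subset_itv; rewrite bnd_simp; move: aA bA; rewrite !ler_norml; lra.
apply: fine_cvg; rewrite fineK; last first.
  by apply: integrable_fin_num => //; exact: rate_integrable.
rewrite [X in _ --> X]IE//.
under eq_fun do rewrite -/(I _ _) IE//.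
have mg a b y : (a%:E < life D i y)%E ->
    measurable_fun (I A A) ((EFin \o rate y) \_ (I a b)).
  move=> ay; have mI b' c' : measurable (I b' c') by exact: measurable_itv.
  apply/(measurable_restrict _ (mI a b) (mI A A)).
  have /measurable_EFinP := @rate_measurable y a b ay.
  exact: (@measurable_funS _ _ _ _ (I a b) _ _ (mI a b) (@subIsetr _ _ _)).
have gL n r : (`|g n r| <= L%:E)%E.
  rewrite /g /patch; case: ifPn => _; last by rewrite abse0 lee_fin ltW.
  by rewrite /= lee_fin ger0_norm; [exact: LP|exact: lambda_ge0].
have gcvg : {ae leb, forall r, I A A r -> g ^~ r @ \oo --> g0 r}.
  exists ([set - s] `|` [set t]); split.
  - exact: measurableU.
  - by apply: null_set_setU => //; exact: lebesgue_measure_set1.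
  move=> r /= /not_implyP[_ gr]; apply: contrapT => /not_orP[rs rt]; apply: gr.
  have sN : - s_ n @[n --> \oo] --> - s by exact: cvgN.
  have [sr|rs'] := ltP (- s) r; last first.
    have {rs'} rs' : r < - s by rewrite lt_neqAle rs' andbT; exact/eqP.
    rewrite /g0 /patch ifF; last first.
      by apply/negbTE; rewrite notin_setE /I/= in_itv/= => /andP[+ _]; rewrite leNgt rs'.
    apply: cvg_near_cst.
    near=> n; rewrite /g /patch ifF//; apply/negbTE; rewrite notin_setE /I/= in_itv/=.
    apply/negP; rewrite negb_and -ltNge; apply/orP; left.
    by near: n; exact: (@cvgr_gt _ _ \oo _ _ _ sN).
  have [tr|rt'] := ltP t r.
    rewrite /g0 /patch ifF; last first.
      by apply/negbTE; rewrite notin_setE /I/= in_itv/= => /andP[_]; rewrite leNgt tr.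
    apply: cvg_near_cst.
    near=> n; rewrite /g /patch ifF//; apply/negbTE; rewrite notin_setE /I/= in_itv/=.
    apply/negP; rewrite negb_and -!ltNge; apply/orP; right.
    by near: n; exact: (@cvgr_lt _ _ \oo _ _ _ tt).
  have {rt'} rt' : r < t by rewrite lt_neqAle rt' andbT; exact/eqP.
  rewrite /g0 /patch ifT; last by rewrite inE /I/= in_itv/= !ltW.
  apply: (@cvg_trans _ ((rate (x_ n) r)%:E @[n --> \oo])).
    apply: near_eq_cvg; near=> n; rewrite /g /patch ifT//.
    rewrite inE /I/= in_itv/=; apply/andP; split.
      by near: n; exact: (@cvgr_le _ _ \oo _ _ _ sN).
    by near: n; exact: (@cvgr_ge _ _ \oo _ _ _ tt).
  apply: cvg_EFin; first exact: nearW.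
  apply: rate_cvg => //; last exact: cvg_cst.
  by rewrite lteNl (lt_trans _ lx)// lte_fin ltrNl.
have mI : measurable (I A A) by exact: measurable_itv.
have [] := @dominated_convergence _ _ R leb (I A A) mI g g0 (EFin \o cst L)
  (fun n => mg _ _ _ (lx_ n)) (mg _ _ _ lx) gcvg (cst_integrable A A L).
  by apply: aeW => r n _; exact: gL.
by [].
Unshelve. all: by end_near. Qed.

End hazard.

Section hazard_shift.
Context {R : realType} {d N : nat} (D : switching R d N) (i : 'I_N).
Implicit Types (x : 'rV[R]_d) (s t r : R).

Lemma integral_shift (f : R -> R) (a b t : R) : a <= b ->
  {within `[a + t, b + t], continuous f} ->
  \int[lebesgue_measure]_(r in `[a + t, b + t]) f r =
  \int[lebesgue_measure]_(r in `[a, b]) f (r + t).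
Proof.
move=> ab fc; congr fine; pose sh (r : R) := r + t.
have sh' : derive1 sh = cst 1.
  apply/funext => r; rewrite derive1E /sh /=.
  by rewrite (@derive_val _ _ _ _ _ _ _ (is_derive_shift r 1 t)).
have shc r : {for r, continuous sh} by apply: cvgD; [exact: cvg_id|exact: cvg_cst].
rewrite (@integration_by_substitution_increasing R sh f a b ab) ?sh'//.
- by apply: eq_integral => r _ /=; rewrite mulr1.
- by move=> u v _ _; rewrite ltrD2r.
- by move=> u _; exact: cvg_cst.
- exact: is_cvg_cst.
- exact: is_cvg_cst.
- split.
  + by move=> r _; exact: (@ex_derive _ _ _ _ _ _ _ (is_derive_shift r 1 t)).
  + by apply: cvg_at_right_filter; exact: shc.
  + by apply: cvg_at_left_filter; exact: shc.
Qed.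

(** Flowing for a time t while ageing by t leaves the accumulated hazard
    unchanged up to the time elapsed. *)
Lemma hazard_shift x s t : (s%:E < life D i x)%E -> 0 <= s -> 0 <= t ->
  hazard D i (phi D i t x) (s + t) 0 = hazard D i x s t.
Proof.
move=> sx s0 t0.
have tx := life_lt0 (phi_flow D i) x t0.
rewrite [RHS]hazardE (_ : - s = - (s + t) + t); last by ring.
rewrite -[X in `[_, X]](add0r t) integral_shift; last 2 first.
- by rewrite oppr_le0 addr_ge0.
- by rewrite add0r opprD addrNK; exact: rate_continuous.
apply: eq_Rintegral => r; rewrite inE/= in_itv/= => /andP[sr _].
rewrite /rate (flow_add (smooth_locally_lipschitz (F_smooth D i)) (phi_flow D i))//.
by rewrite lteNl (le_lt_trans _ sx)// lee_fin; lra.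
Qed.

End hazard_shift.

(** * The state space and the jump time psi *)

Section states.
Context {R : realType} {d N : nat} (D : switching R d N).
Local Notation space := ('rV[R]_d * R * discrete_topology 'I_N)%type.
Implicit Types (i : 'I_N) (x : 'rV[R]_d) (s t r u : R) (z : space).

Lemma in_K x s i : K D (x, s, i) <->
  [/\ 0 <= s, (s%:E < life D i x)%E & 0 < G D i (hazard D i x s 0)].
Proof.
by split=> -[s0 sx] /(survival_gt0 D i (hazard_ge0 D i x s 0)) h; split.
Qed.

Lemma hazard00 i x : hazard D i x 0 0 = 0.
Proof. by rewrite /hazard oppr0 set_itv1 Rintegral_set1. Qed.

Lemma post_jump_in_K x i : K D (x, 0, i).
Proof.
apply/in_K; split => //; first exact: life_gt0 (phi_flow D i) x.
by rewrite hazard00 survival0.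
Qed.

Lemma Gz_nonincreasing z t t' : K D z -> t <= t' -> Gz D z t' <= Gz D z t.
Proof.
move: z => [[x s] i] /in_K[s0 sx G0] tt' /=.
rewrite ler_pM2r ?invr_gt0//; apply: survival_nonincreasing.
exact: hazard_nondecreasing.
Qed.

Lemma Gz0 z : K D z -> Gz D z 0 = 1.
Proof. by move: z => [[x s] i] /in_K[s0 sx G0] /=; rewrite divff// gt_eqF. Qed.

Lemma Gz_small z u : K D z -> 0 < u -> exists2 r, 0 <= r & Gz D z r <= u.
Proof.
move: z => [[x s] i] /in_K[s0 sx G0] u0.
have [c c0 cP] := lambda_lower D.
have [M MP] : exists M, G D i M <= u * G D i (hazard D i x s 0).
  have /cvgr_lt/(_ (u * G D i (hazard D i x s 0))) := survival_cvgy D i.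
  by rewrite mulr_gt0// => /(_ isT)/filter_ex[M /ltW]; exists M.
exists (`|M| / c) => /=; first by rewrite divr_ge0// ltW.
rewrite ler_pdivrMr// (le_trans _ MP)// survival_nonincreasing//.
apply: le_trans (hazard_lower _ sx _) => //; last first.
  by rewrite (@le_trans _ _ 0)// ?oppr_le0// divr_ge0// ltW.
apply: le_trans (ler_norm _) _.
by rewrite mulrDr [c * (_ / _)]mulrC divfK ?gt_eqF// lerDr mulr_ge0// ltW.
Qed.

Lemma psi_ge0 z u : 0 <= psi D z u.
Proof.
rewrite /psi; set A := [set r | _]; have [->|A0] := eqVneq A set0; first by rewrite inf0.
by apply: lb_le_inf => [|r []//]; exact/set0P.
Qed.

Lemma psi_le z u r : 0 <= r -> Gz D z r <= u -> psi D z u <= r.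
Proof.
by move=> r0 Gr; apply: ge_inf => //; exists 0 => y [].
Qed.

Lemma lt_Gz_psi z u r : 0 <= r -> r < psi D z u -> u < Gz D z r.
Proof.
move=> r0; apply: contraTT; rewrite -!leNgt; exact: psi_le.
Qed.

Lemma ge_psi z u q : K D z -> 0 < u ->
  (forall r, 0 <= r -> Gz D z r <= u -> q <= r) -> q <= psi D z u.
Proof.
move=> Kz u0 qP; apply: lb_le_inf => [|r []]; last exact: qP.
by have [r r0 Gr] := Gz_small Kz u0; exists r.
Qed.

Lemma psi_lt z u r : K D z -> 0 < u -> psi D z u < r -> Gz D z r <= u.
Proof.
move=> Kz u0; rewrite -subr_gt0 => e0.
have hi : has_inf [set r | 0 <= r /\ Gz D z r <= u].
  split; last by exists 0 => y [].
  by have [q q0 Gq] := Gz_small Kz u0; exists q.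
have [q [q0 Gq]] := inf_adherent e0 hi.
rewrite -/(psi D z u) subrKC => qr.
exact: le_trans (Gz_nonincreasing Kz (ltW qr)) Gq.
Qed.

(** A state that still survives with positive probability after a time t has not
    left K by then. *)
Lemma flow_in_K z t : K D z -> 0 <= t -> 0 < Gz D z t -> K D (flow D z t).
Proof.
move: z => [[x s] i] /in_K[s0 sx G0] t0 /= Gt; apply/in_K; split.
- exact: addr_ge0.
- apply: lt_le_trans (life_shift (phi_flow D i) (life_lt0 (phi_flow D i) x t0)).
  by rewrite EFinD lteD2rE.
- by rewrite hazard_shift//; move: Gt; rewrite pmulr_lgt0// invr_gt0.
Qed.

End states.

(** * Sequential continuity of the jump mechanism *)

Section sequential.
Context {R : realType} {d N : nat} (D : switching R d N).
Local Notation space := ('rV[R]_d * R * discrete_topology 'I_N)%type.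
Implicit Types (i j : 'I_N) (x : 'rV[R]_d) (s t r u v : R) (z : space).

Lemma cvg_space (z_ : nat -> space) z : z_ @ \oo --> z <->
  [/\ (z_ n).1.1 @[n --> \oo] --> z.1.1, (z_ n).1.2 @[n --> \oo] --> z.1.2 &
    \forall n \near \oo, (z_ n).2 = z.2].
Proof.
split=> [zz|[xx ss ii]].
  have zz1 : (z_ n).1 @[n --> \oo] --> z.1 by exact: cvg_comp zz cvg_fst.
  split; [exact: cvg_comp zz1 cvg_fst|exact: cvg_comp zz1 cvg_snd|].
  have : (z_ n).2 @[n --> \oo] --> z.2 by exact: cvg_comp zz cvg_snd.
  move=> /(_ [set z.2]); apply.
  by rewrite nbhs_principalE; apply/principal_filterP.
have -> : z_ = (fun n => ((z_ n).1, (z_ n).2)).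
  by apply/funext => n; rewrite -surjective_pairing.
apply: (@cvg_pair _ _ _ \oo (nbhs z.1) (nbhs z.2)); last by apply: cvg_near_cst.
have -> : (fun n => (z_ n).1) = (fun n => ((z_ n).1.1, (z_ n).1.2)).
  by apply/funext => n; rewrite -surjective_pairing.
exact: (@cvg_pair _ _ _ \oo (nbhs z.1.1) (nbhs z.1.2)).
Qed.

Hypothesis G_continuous : forall i, {within `[0, +oo[, continuous (G D i)}.

Lemma survival_cvg i (h_ : nat -> R) (h : R) : (forall n, 0 <= h_ n) -> 0 <= h ->
  h_ @ \oo --> h -> G D i (h_ n) @[n --> \oo] --> G D i h.
Proof.
move=> h_0 h0 hh.
have /subspace_continuousP/(_ h) := @G_continuous i.
rewrite /= in_itv/= h0 => /(_ isT) Gh; apply: cvg_comp Gh.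
move=> A /= /hh; rewrite /nbhs/=; apply: filterS => n; apply.
by rewrite /= in_itv/= h_0.
Qed.

(** Indices are eventually constant along a convergent sequence of states, so it
    suffices to follow the hazard of the limit index. *)
Lemma Gz_cvg (z_ : nat -> space) (t_ : nat -> R) z t :
  (forall n, K D (z_ n)) -> K D z -> z_ @ \oo --> z -> t_ @ \oo --> t ->
  Gz D (z_ n) (t_ n) @[n --> \oo] --> Gz D z t.
Proof.
move: z => [[x s] i] Kz_ Kz /cvg_space[/= xx ss ii] tt.
pose x' n := if (z_ n).2 == i then (z_ n).1.1 else x.
pose s' n := if (z_ n).2 == i then (z_ n).1.2 else s.
have x'E : \forall n \near \oo, (z_ n) = (x' n, s' n, i).
  near=> n; have zi : (z_ n).2 = i by near: n.
  by rewrite /x' /s' zi eqxx -zi; case: (z_ n) => -[].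
have Kz' n : K D (x' n, s' n, i).
  by rewrite /x' /s'; have := Kz_ n; case: (z_ n) => -[y q] j /=; case: eqP => [->|].
have xx' : x' @ \oo --> x.
  apply: cvg_trans xx; apply: near_eq_cvg.
  by near=> n; rewrite /x'; have -> : (z_ n).2 = i; [by near: n|rewrite eqxx].
have ss' : s' @ \oo --> s.
  apply: cvg_trans ss; apply: near_eq_cvg.
  by near=> n; rewrite /s'; have -> : (z_ n).2 = i; [by near: n|rewrite eqxx].
apply: (@cvg_trans _ (Gz D (x' n, s' n, i) (t_ n) @[n --> \oo])).
  by apply: near_eq_cvg; near=> n; rewrite -(near x'E n).
have /in_K[s0 sx G0] := Kz.
have lx n : ((s' n)%:E < life D i (x' n))%E by have /in_K[] := Kz' n.
rewrite /Gz; apply: cvgM.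
  by apply: survival_cvg => [n||]; rewrite ?hazard_ge0//; exact: hazard_cvg.
apply: cvgV; first by rewrite gt_eqF.
apply: survival_cvg => [n||]; rewrite ?hazard_ge0//; apply: hazard_cvg => //.
exact: cvg_cst.
Unshelve. all: by end_near. Qed.

(** Right-continuity of the survival function gives one inequality,
    left-continuity the other. *)
Lemma Gz_psi z u : K D z -> 0 < u <= 1 -> Gz D z (psi D z u) = u.
Proof.
move=> Kz /andP[u0 u1]; apply/eqP; rewrite eq_le; apply/andP; split.
  have cG : Gz D z (psi D z u + n.+1%:R^-1) @[n --> \oo] --> Gz D z (psi D z u).
    apply: (@Gz_cvg (fun=> z)) => //; first exact: cvg_cst.
    rewrite -[X in _ --> X]addr0; apply: cvgD; first exact: cvg_cst.
    exact: cvg_harmonic.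
  apply: (cvgr_to_le cG).
  by apply: nearW => n; apply: psi_lt => //; rewrite ltrDl invr_gt0.
have [p0|p0] := eqVneq (psi D z u) 0; first by rewrite p0 Gz0.
have {}p0 : 0 < psi D z u by rewrite lt_neqAle eq_sym p0 psi_ge0.
have cG : Gz D z (psi D z u - n.+1%:R^-1) @[n --> \oo] --> Gz D z (psi D z u).
  apply: (@Gz_cvg (fun=> z)) => //; first exact: cvg_cst.
  rewrite -[X in _ --> X]subr0; apply: cvgB; first exact: cvg_cst.
  exact: cvg_harmonic.
apply: (cvgr_to_ge cG).
near=> n; apply/ltW/lt_Gz_psi; last by rewrite ltrBlDr ltrDl invr_gt0.
rewrite subr_ge0; near: n.
exact: (@cvgr_le _ _ \oo _ _ _ (@cvg_harmonic R) _ p0).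
Unshelve. all: by end_near. Qed.

(** A generalized inverse is continuous at the levels u at which the inverted
    function is not flat.  A flat stretch of positive length contains a rational
    time, so it is enough that u be no value at a rational time. *)
Lemma psi_cvg (z_ : nat -> space) (u_ : nat -> R) z u :
  (forall n, K D (z_ n)) -> K D z -> z_ @ \oo --> z -> u_ @ \oo --> u ->
  (forall n, 0 < u_ n) -> 0 < u ->
  (forall q : rat, 0 <= q -> Gz D z (ratr q) != u) ->
  psi D (z_ n) (u_ n) @[n --> \oo] --> psi D z u.
Proof.
move=> Kz_ Kz zz uu u_0 u0 zu.
have ratr0 (q : rat) : 0 <= (ratr q : R) -> 0 <= q by rewrite ler0q.
have Gq (q : rat) : Gz D (z_ n) (ratr q) @[n --> \oo] --> Gz D z (ratr q).
  by apply: Gz_cvg => //; exact: cvg_cst.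
have Gu (q : rat) : Gz D (z_ n) (ratr q) - u_ n @[n --> \oo] --> Gz D z (ratr q) - u.
  exact: cvgB.
apply/cvgrPdist_le => e e0.
have Slt : psi D z u < psi D z u + e by rewrite ltrDl.
have [q] := rat_in_itvoo Slt.
rewrite in_itv/= => /andP[qS qe].
have q0 : 0 <= (ratr q : R) by rewrite (le_trans (psi_ge0 D z u))// ltW.
have Gqu : Gz D z (ratr q) - u < 0.
  by rewrite subr_lt0 lt_neqAle zu ?ratr0//= psi_lt.
have up : \forall n \near \oo, psi D (z_ n) (u_ n) <= ratr q.
  near=> n; apply: psi_le => //; rewrite -subr_le0.
  by near: n; exact: (@cvgr_le _ _ \oo _ _ _ (Gu q)).
have lo : \forall n \near \oo, psi D z u - e <= psi D (z_ n) (u_ n).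
  have [Se|Se] := ltP (psi D z u - e) 0.
    by apply: nearW => n; rewrite (le_trans (ltW Se))// psi_ge0.
  have ltS : psi D z u - e < psi D z u by rewrite ltrBlDr ltrDl.
  have [p] := rat_in_itvoo ltS.
  rewrite in_itv/= => /andP[pe pS].
  have p0 : 0 <= (ratr p : R) by rewrite (le_trans Se)// ltW.
  have Gpu : 0 < Gz D z (ratr p) - u by rewrite subr_gt0 lt_Gz_psi.
  near=> n; apply: (le_trans (ltW pe)); apply: ge_psi => // r r0 Gr.
  rewrite leNgt; apply/negP => rp.
  have : 0 < Gz D (z_ n) (ratr p) - u_ n.
    by near: n; exact: (@cvgr_gt _ _ \oo _ _ _ (Gu p)).
  rewrite subr_gt0 ltNge => /negP; apply; apply: le_trans Gr.
  exact: (Gz_nonincreasing (Kz_ n) (ltW rp)).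
near=> n; rewrite distrC ler_distl; apply/andP; split; first by near: n.
by rewrite (le_trans _ (ltW qe))//; near: n.
Unshelve. all: by end_near. Qed.

End sequential.

Section switching_index.
Context {R : realType} {d N : nat} (D : switching R d N).
Implicit Types (i j : 'I_N) (x : 'rV[R]_d) (v : R).

Definition cumQ x i j : R := \sum_(l < N | (l <= j)%N) Q D x i l.
Definition cumQ_lt x i j : R := \sum_(l < N | (l < j)%N) Q D x i l.

Lemma Q_ge0 x i j : 0 <= Q D x i j.
Proof. by have [] := Q_stochastic D x. Qed.

Lemma Q_partial_sum_le (p q : pred 'I_N) x i : subpred p q ->
  \sum_(l < N | p l) Q D x i l <= \sum_(l < N | q l) Q D x i l.
Proof.
move=> pq; rewrite [leRHS](bigID p)/= (eq_bigl p) ?lerDl ?sumr_ge0// => [l _|l].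
  exact: Q_ge0.
by have [/pq->|] := boolP (p l); rewrite ?andbT ?andbF.
Qed.

Lemma next_index_eq x i j v : cumQ_lt x i j < v <= cumQ x i j ->
  next_index D i x v = j.
Proof.
move=> /andP[jv vj]; rewrite /next_index.
case: pickP => [j' /andP[j'v vj']|/(_ j)]; last by rewrite -/(cumQ_lt x i j) jv vj.
apply: ord_inj; case: (ltngtP j' j) => // jj'; exfalso.
- have : v < v; last by rewrite ltxx.
  apply: le_lt_trans jv; apply: (le_trans vj').
  by apply: Q_partial_sum_le => l /leq_ltn_trans; apply.
- have : v < v; last by rewrite ltxx.
  apply: le_lt_trans j'v; apply: (le_trans vj).
  by apply: Q_partial_sum_le => l /leq_ltn_trans; apply.
Qed.

(** The slots of the row Q x i tile ]0, 1]; minimality of j among the indices whose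
    partial sum reaches v gives the strict lower bound. *)
Lemma index_slot x i v : 0 < v <= 1 -> exists j, cumQ_lt x i j < v <= cumQ x i j.
Proof.
move=> /andP[v0 v1].
have [j0 j0P] : exists j, v <= cumQ x i j.
  have N0 : (0 < N)%N := leq_ltn_trans (leq0n i) (ltn_ord i).
  have N1 : (N.-1 < N)%N by rewrite prednK.
  exists (Ordinal N1); apply: (le_trans v1).
  have [_ /(_ i)<-] := Q_stochastic D x.
  rewrite le_eqVlt; apply/orP; left; apply/eqP/esym.
  by apply: eq_bigl => l /=; rewrite -ltnS prednK ?ltn_ord.
have [j vj jmin] := @arg_minnP _ j0 [pred j | v <= cumQ x i j] (fun j => val j) j0P.
move: vj => /= vj; exists j; rewrite vj andbT ltNge; apply/negP => vlt.
case: (posnP j) => [j00|jpos].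
  move: vlt; rewrite /cumQ_lt big1 ?leNgt ?v0// => l.
  by rewrite j00.
have jN : (j.-1 < N)%N by rewrite (leq_ltn_trans (leq_pred _) (ltn_ord j)).
have : v <= cumQ x i (Ordinal jN).
  rewrite (le_trans vlt)//; apply: Q_partial_sum_le => l /= lj.
  by rewrite -ltnS prednK.
by move=> /jmin/=; rewrite leqNgt ltn_predL jpos.
Qed.

Lemma cumQ_cvg (p : pred 'I_N) (x_ : nat -> 'rV[R]_d) x i : x_ @ \oo --> x ->
  \sum_(l < N | p l) Q D (x_ n) i l @[n --> \oo] --> \sum_(l < N | p l) Q D x i l.
Proof.
move=> xx; have cQ l : Q D (x_ n) i l @[n --> \oo] --> Q D x i l.
  have cQ : Q D (x_ n) @[n --> \oo] --> Q D x by exact: cvg_comp xx (@Q_continuous _ _ _ D x).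
  exact: cvg_comp cQ (@coord_continuous _ _ _ i l (Q D x)).
elim: (index_enum _) => [|l s IHs].
  by rewrite big_nil; under eq_fun do rewrite big_nil; exact: cvg_cst.
rewrite big_cons; under eq_fun do rewrite big_cons.
by case: ifP => // _; exact: cvgD.
Qed.

(** Off the partial sums of the row, v lies in the interior of its slot, and it
    stays there under small perturbations of the row. *)
Lemma next_index_cvg (x_ : nat -> 'rV[R]_d) (v_ : nat -> R) x i v :
  0 < v <= 1 -> (forall j, cumQ x i j != v) -> x_ @ \oo --> x -> v_ @ \oo --> v ->
  \forall n \near \oo, next_index D i (x_ n) (v_ n) = next_index D i x v.
Proof.
move=> v01 vQ xx vv; have [j jv] := index_slot x i v01.
rewrite (next_index_eq jv); move: jv => /andP[jv vj].
have {}vj : v < cumQ x i j by rewrite lt_neqAle eq_sym vQ.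
have lo : cumQ_lt (x_ n) i j - v_ n @[n --> \oo] --> cumQ_lt x i j - v.
  by apply: cvgB => //; exact: cumQ_cvg.
have up : cumQ (x_ n) i j - v_ n @[n --> \oo] --> cumQ x i j - v.
  by apply: cvgB => //; exact: cumQ_cvg.
near=> n; apply: next_index_eq; apply/andP; split.
  rewrite -subr_lt0; near: n; apply: (@cvgr_lt _ _ \oo _ _ _ lo).
  by rewrite subr_lt0.
rewrite -subr_ge0; near: n; apply: (@cvgr_ge _ _ \oo _ _ _ up).
by rewrite subr_gt0.
Unshelve. all: by end_near. Qed.

End switching_index.

(** * Sequential continuity of the process *)

Section trajectories.
Context {R : realType} {d N : nat} (D : switching R d N).
Local Notation space := ('rV[R]_d * R * discrete_topology 'I_N)%type.
Implicit Types (i j : 'I_N) (x : 'rV[R]_d) (s t : R) (u v : nat -> R) (z : K D).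

Definition unit_seq u := forall k, 0 < u k <= 1.

Lemma K_val z : K D (val z).
Proof. by have := valP z; rewrite in_setE. Qed.

Lemma jump_time0 u v z : jump_time u v z 0 = 0. Proof. by []. Qed.

Lemma post_jump0 u v z : post_jump u v z 0 = val z. Proof. by []. Qed.

Lemma jump_timeS u v z k : jump_time u v z k.+1 =
  jump_time u v z k + psi D (post_jump u v z k) (u k.+1).
Proof.
by rewrite /jump_time /post_jump /=; case: (skeleton u v z k) => T [[x s] i].
Qed.

Definition landing (w : space) (r : R) : 'rV[R]_d := phi D w.2 (psi D w r) w.1.1.

Lemma post_jumpS u v z k (w := post_jump u v z k) : post_jump u v z k.+1 =
  (landing w (u k.+1), 0, next_index D w.2 (landing w (u k.+1)) (v k.+1)).
Proof.
by rewrite /w /post_jump /=; case: (skeleton u v z k) => T [[x s] i].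
Qed.

Lemma post_jump_K u v z k : K D (post_jump u v z k).
Proof.
case: k => [|k]; first exact: K_val.
rewrite post_jumpS; exact: post_jump_in_K.
Qed.

Lemma jump_time_nondecreasing u v z : nondecreasing_seq (jump_time u v z).
Proof.
by apply/nondecreasing_seqP => k; rewrite jump_timeS lerDl psi_ge0.
Qed.

Lemma jump_time_ge0 u v z k : 0 <= jump_time u v z k.
Proof. exact: (jump_time_nondecreasing u v z (leq0n k)). Qed.

Lemma flow_between_K u v z k t : unit_seq u ->
  jump_time u v z k <= t < jump_time u v z k.+1 ->
  K D (flow D (post_jump u v z k) (t - jump_time u v z k)).
Proof.
move=> u01 /andP[kt tk]; apply: flow_in_K; first exact: post_jump_K.
  by rewrite subr_ge0.
apply: (lt_trans (andP (u01 k.+1)).1); apply: lt_Gz_psi; first by rewrite subr_ge0.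
by rewrite ltrBlDl -jump_timeS.
Qed.

Lemma jump_slot_unique u v z k l t :
  jump_time u v z k <= t < jump_time u v z k.+1 ->
  jump_time u v z l <= t < jump_time u v z l.+1 -> k = l.
Proof.
move=> /andP[kt tk] /andP[lt tl]; case: (ltngtP k l) => // kl.
- have := le_lt_trans (le_trans (jump_time_nondecreasing u v z kl) lt) tk.
  by rewrite ltxx.
- have := le_lt_trans (le_trans (jump_time_nondecreasing u v z kl) kt) tl.
  by rewrite ltxx.
Qed.

(** The slots [T_k, T_{k+1}[ are disjoint, so the choice made in the definition of
    the state is forced. *)
Lemma val_state_at u v z k t : unit_seq u ->
  jump_time u v z k <= t < jump_time u v z k.+1 ->
  val (state_at u v z t) = flow D (post_jump u v z k) (t - jump_time u v z k).
Proof.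
move=> u01 kt; rewrite /state_at.
case: xgetP => [y _ [l lt ->]|/(_ (flow D (post_jump u v z k) (t - jump_time u v z k)))].
  by rewrite (jump_slot_unique lt kt) val_insubd mem_set//; exact: flow_between_K.
by case; exists k.
Qed.

(** What the k-th pair of uniform variables (a, b) must avoid for the jump out of w
    to be continuous. *)
Record good_step (w : space) (a b : R) : Prop := GoodStep {
  good_survival : forall q : rat, 0 <= q -> Gz D w (ratr q) != a ;
  good_index : forall j, cumQ D (landing w a) w.2 j != b }.

(** For continuous survival functions, the middle condition excludes a jump at
    time t exactly ([Gz_psi]). *)
Definition good_path u v z t :=
  [/\ forall k, good_step (post_jump u v z k) (u k.+1) (v k.+1),
      forall k, Gz D (post_jump u v z k) (t - jump_time u v z k) != u k.+1 &
      exists k, t < jump_time u v z k].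

Hypothesis G_continuous : forall i, {within `[0, +oo[, continuous (G D i)}.

Lemma flow_space_cvg (w_ : nat -> space) (t_ : nat -> R) (w : space) t :
  0 <= t -> w_ @ \oo --> w -> t_ @ \oo --> t ->
  flow D (w_ n) (t_ n) @[n --> \oo] --> flow D w t.
Proof.
move: w => [[x s] i] t0 /cvg_space[/= xx ss ii] tt; apply/cvg_space.
have flowE (y : space) r : flow D y r = (phi D y.2 r y.1.1, y.1.2 + r, y.2).
  by case: y => -[].
under eq_fun do rewrite flowE; split => /=.
- apply: (@cvg_trans _ (phi D i (t_ n) (w_ n).1.1 @[n --> \oo])).
    by apply: near_eq_cvg; near=> n; have -> : (w_ n).2 = i by near: n.
  apply: (flow_cvg (smooth_locally_lipschitz (F_smooth D i)) (phi_flow D i)) => //.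
  exact: (life_lt0 (phi_flow D i) x t0).
- by under eq_fun do rewrite flowE/=; exact: cvgD.
- by near=> n; rewrite flowE /=; near: n.
Unshelve. all: by end_near. Qed.

(** Only the first k jumps have to be good: this lets the goodness of jump k + 1 be
    proved almost surely from that of its predecessors. *)
Lemma skeleton_cvg (u_ v_ : nat -> nat -> R) (z_ : nat -> K D) u v z k :
  (forall n, unit_seq (u_ n)) -> unit_seq u -> unit_seq v ->
  (forall l, u_ ^~ l @ \oo --> u l) -> (forall l, v_ ^~ l @ \oo --> v l) ->
  val (z_ n) @[n --> \oo] --> val z ->
  (forall l, (l < k)%N -> good_step (post_jump u v z l) (u l.+1) (v l.+1)) ->
  jump_time (u_ n) (v_ n) (z_ n) k @[n --> \oo] --> jump_time u v z k /\
  post_jump (u_ n) (v_ n) (z_ n) k @[n --> \oo] --> post_jump u v z k.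
Proof.
move=> u_01 u01 v01 uu vv zz; elim: k => [_|k IHk good].
  by split => //; exact: cvg_cst.
have [|Tk Zk] := IHk; first by move=> l lk; apply: good; rewrite (ltn_trans lk).
have [gG gQ] := good k (leqnn _).
have Kn n := post_jump_K (u_ n) (v_ n) (z_ n) k.
have Kk := post_jump_K u v z k.
have psik : psi D (post_jump (u_ n) (v_ n) (z_ n) k) (u_ n k.+1) @[n --> \oo] -->
    psi D (post_jump u v z k) (u k.+1).
  apply: psi_cvg => //; [by move=> n; have /andP[] := u_01 n k.+1|].
  by have /andP[] := u01 k.+1.
split.
  by rewrite jump_timeS; under eq_fun do rewrite jump_timeS; exact: cvgD.
have /cvg_space[/= lk _ ik] := flow_space_cvg (psi_ge0 _ _ _) Zk psik.
have flow1 (y : space) r : (flow D y r).1.1 = phi D y.2 r y.1.1 by case: y => -[].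
have flow2 (y : space) r : (flow D y r).2 = y.2 by case: y => -[].
move: lk; rewrite flow1; under eq_fun do rewrite flow1.
rewrite -[X in _ --> X]/(landing _ _) => lk.
apply/cvg_space; rewrite post_jumpS /=; split.
- by under eq_fun do rewrite post_jumpS.
- by under eq_fun do rewrite post_jumpS; exact: cvg_cst.
have nk := next_index_cvg (v01 k.+1) gQ lk (vv k.+1).
have {}ik : \forall n \near \oo,
    (post_jump (u_ n) (v_ n) (z_ n) k).2 = (post_jump u v z k).2.
  by apply: filterS ik => n; rewrite !flow2.
near=> n; rewrite post_jumpS /=.
have -> : (post_jump (u_ n) (v_ n) (z_ n) k).2 = (post_jump u v z k).2 by near: n.
by near: n.
Unshelve. all: by end_near. Qed.

Lemma jump_slot u v z t : 0 <= t -> (exists k, t < jump_time u v z k) ->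
  exists k, jump_time u v z k <= t < jump_time u v z k.+1.
Proof.
move=> t0 ex; case: (ex_minnP ex) => -[|k]; first by rewrite jump_time0 ltNge t0.
move=> tk kmin; exists k; rewrite tk andbT leNgt; apply/negP => /kmin.
by rewrite ltnn.
Qed.

Lemma state_at_cvg (u_ v_ : nat -> nat -> R) (z_ : nat -> K D) (t_ : nat -> R)
    u v z t :
  (forall n, unit_seq (u_ n)) -> unit_seq u -> unit_seq v ->
  (forall l, u_ ^~ l @ \oo --> u l) -> (forall l, v_ ^~ l @ \oo --> v l) ->
  val (z_ n) @[n --> \oo] --> val z -> (forall n, 0 <= t_ n) -> 0 <= t ->
  t_ @ \oo --> t -> good_path u v z t ->
  val (state_at (u_ n) (v_ n) (z_ n) (t_ n)) @[n --> \oo] -->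
  val (state_at u v z t).
Proof.
move=> u_01 u01 v01 uu vv zz t_0 t0 tt [good goodt ext].
have [k kt] := jump_slot t0 ext; have /andP[Tkt tTk] := kt.
have cv l := skeleton_cvg u_01 u01 v01 uu vv zz (fun l' (_ : (l' < l)%N) => good l').
have [Tk Zk] := cv k; have [Tk1 _] := cv k.+1.
rewrite (val_state_at u01 kt).
have lo : \forall n \near \oo, jump_time (u_ n) (v_ n) (z_ n) k <= t_ n.
  have [k0|k0] := posnP k; first by apply: nearW => n; rewrite k0 jump_time0.
  near=> n; rewrite -subr_ge0; near: n.
  apply: (@cvgr_ge _ _ \oo _ _ _ (cvgB tt Tk)).
  rewrite subr_gt0 lt_neqAle Tkt andbT; apply/eqP => Tkt'.
  (* a jump exactly at time t would put u on the survival curve of its predecessor *)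
  have /eqP := goodt k.-1; apply.
  rewrite -Tkt' -(prednK k0) jump_timeS addrAC subrr add0r.
  by apply: Gz_psi => //; exact: post_jump_K.
have up : \forall n \near \oo, t_ n < jump_time (u_ n) (v_ n) (z_ n) k.+1.
  near=> n; rewrite -subr_gt0; near: n.
  apply: (@cvgr_gt _ _ \oo _ _ _ (cvgB Tk1 tt)).
  by rewrite subr_gt0.
apply: (@cvg_trans _ (flow D (post_jump (u_ n) (v_ n) (z_ n) k)
    (t_ n - jump_time (u_ n) (v_ n) (z_ n) k) @[n --> \oo])).
  by apply: near_eq_cvg; near=> n; rewrite -val_state_at//; apply/andP; split; near: n.
by apply: flow_space_cvg => //; [rewrite subr_ge0|exact: cvgB].
Unshelve. all: by end_near. Qed.

End trajectories.

(** * Rounding the uniform variables *)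

Section digits.
Context {R : realType}.
Implicit Types (x : R) (n k : nat).

(** Grid points of mesh 1 / n.+1.  Scaling by n before truncating, and adding 1
    afterwards, keeps the rounded value of a point of ]0, 1] inside ]0, 1]. *)
Definition digit n x : nat := Num.truncn (n%:R * x).

Definition level n x : R := (digit n x).+1%:R / n.+1%:R.

Definition slot n k : set R := [set x | k%:R <= n%:R * x < k.+1%:R].

Lemma slotP n k x : 0 <= x -> slot n k x <-> digit n x = k.
Proof.
move=> x0; have nx0 : 0 <= n%:R * x by rewrite mulr_ge0.
by rewrite /slot /digit /= -truncn_eq//; split => [/eqP|->].
Qed.

Lemma slot_measurable n k : measurable (slot n k).
Proof.
have -> : slot n k = ( *%R n%:R) @^-1` `[k%:R, k.+1%:R[%classic.
  by apply/seteqP; split => x /=; rewrite in_itv.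
by rewrite -[X in measurable X]setTI; exact: mulrl_measurable.
Qed.

Lemma digit_lt n x : 0 <= x <= 1 -> (digit n x < n.+1)%N.
Proof.
move=> /andP[x0 x1]; rewrite truncn_lt_nat ?mulr_ge0//.
apply: (@le_lt_trans _ _ (n%:R * 1)); first by rewrite ler_wpM2l.
by rewrite mulr1 ltr_nat.
Qed.

Lemma level_unit n x : 0 < x <= 1 -> 0 < level n x <= 1.
Proof.
move=> /andP[x0 x1]; rewrite divr_gt0//= ler_pdivrMr// mul1r ler_nat.
by rewrite digit_lt// (ltW x0).
Qed.

Lemma level_close n x : 0 < x <= 1 -> `|x - level n x| <= n.+1%:R^-1.
Proof.
move=> /andP[x0 x1]; have nx0 : 0 <= n%:R * x by rewrite mulr_ge0// ltW.
have /andP[dl du] := truncn_itv nx0; rewrite -/(digit n x) in dl du.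
have n0 : (n.+1%:R : R) != 0 by rewrite pnatr_eq0.
have -> : x - level n x = (n.+1%:R * x - (digit n x).+1%:R) / n.+1%:R.
  by rewrite mulrBl mulrAC mulfV// mul1r.
rewrite normrM [`|_^-1|]ger0_norm// ler_piMl// ler_norml.
by move: dl du; rewrite -!natr1 mulrDl mul1r; set a := n%:R * x; lra.
Qed.

Lemma level_cvg x : 0 < x <= 1 -> level n x @[n --> \oo] --> x.
Proof.
move=> x01; apply/cvgrPdist_le => e e0; near=> n.
apply: le_trans (level_close n x01) _; near: n.
exact: (@cvgr_le _ _ \oo _ _ _ (@cvg_harmonic R) _ e0).
Unshelve. all: by end_near. Qed.

End digits.

Section finite_partition.
Context {d} {T : measurableType d} {R : realType} (P : probability T R).

(** A bound on conditional probabilities given each of finitely many cells is a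
    bound on the total probability. *)
Lemma probability_partition (C : finType) (key : T -> C) (E : C -> set T) (b : \bar R) :
  (0 <= b)%E -> (forall c, measurable (key @^-1` [set c])) ->
  (forall c, measurable (E c)) ->
  (forall c, (P (key @^-1` [set c] `&` E c) <= b * P (key @^-1` [set c]))%E) ->
  measurable [set w | E (key w) w] /\ (P [set w | E (key w) w] <= b)%E.
Proof.
move=> b0 mk mE Eb.
have fC : finite_set [set: C] by exact: finite_finset.
have disj (F : C -> set T) : trivIset setT (fun c => key @^-1` [set c] `&` F c).
  by move=> c c' _ _ [w [[/= <- _] [/= <- _]]].
have EE : [set w | E (key w) w] = \bigcup_(c in [set: C]) (key @^-1` [set c] `&` E c).
  by apply/seteqP; split => [w Ew|w [c _ [/= <-]]//]; exists (key w).
have mI c : measurable (key @^-1` [set c] `&` E c) by exact: measurableI.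
split.
  by rewrite EE; apply: fin_bigcup_measurable.
rewrite EE measure_fin_bigcup//.
apply: (@le_trans _ _ (\sum_(c \in [set: C]) (b * P (key @^-1` [set c])))%E).
  by apply: lee_fsum => // c _; exact: Eb.
rewrite -ge0_mule_fsumr//.
have tot : \bigcup_(c in [set: C]) (key @^-1` [set c]) = setT.
  by apply/seteqP; split => // w _; exists (key w).
have trK : trivIset setT (fun c => key @^-1` [set c]).
  by move=> c c' _ _ [w [/= <- <-]].
rewrite -measure_fin_bigcup// tot.
by rewrite [X in (_ * X <= _)%E](probability_setT P) mule1.
Qed.

End finite_partition.

Section discretization.
Context {R : realType} {dO : measure_display} {Omega : measurableType dO}
  (P : probability Omega R) (I : countType) (X : I -> {RV P >-> R}).
Hypotheses (X_unif : forall i, uniform01 (X i)) (X_indep : mutually_independent X).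
Implicit Types (i : I) (n : nat) (s : seq I) (w : I -> R) (om : Omega).

(** The family w seen through finitely many rounded coordinates; 1 is a default
    value in ]0, 1]. *)
Definition coarse s n w i : R := if i \in s then level n (w i) else 1.

(* the finite datum through which [coarse] factors *)
Let key s n om : {ffun seq_sub s -> 'I_n.+1} :=
  [ffun j => inord (digit n (X (val j) om))].

Let decode s n (c : {ffun seq_sub s -> 'I_n.+1}) i : R :=
  if insub i is Some j then (c j).+1%:R / n.+1%:R else 1.

Let digit_of s n (c : {ffun seq_sub s -> 'I_n.+1}) i : nat :=
  if insub i is Some j then c j : nat else 0%N.

Lemma X_unit i om : 0 < X i om <= 1. Proof. exact: (X_unif i).1. Qed.

Lemma X_ge0 i om : 0 <= X i om. Proof. by have /andP[/ltW] := X_unit i om. Qed.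

Lemma X_digit_lt n i om : (digit n (X i om) < n.+1)%N.
Proof. by apply: digit_lt; have /andP[/ltW -> ->] := X_unit i om. Qed.

Let coarse_decode s n om : coarse s n (X ^~ om) = decode (key s n om).
Proof.
apply/funext => i; rewrite /coarse /decode.
case: insubP => [j is_ ji|/negPf->//]; rewrite is_ ffunE inordK ?X_digit_lt//.
by rewrite ji.
Qed.

Let key_preimage s n c : key s n @^-1` [set c] =
  \bigcap_(i in [set` s]) X i @^-1` slot n (digit_of c i).
Proof.
apply/seteqP; split => [om /= <- i is_|om cell] /=.
  apply/(slotP _ _ (X_ge0 i om)); rewrite /digit_of (insubT (mem s) is_) ffunE inordK//.
  exact: X_digit_lt.
apply/ffunP => j; rewrite ffunE; apply/val_inj; rewrite /= inordK ?X_digit_lt//.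
have := cell (val j) (valP j) => /(slotP _ _ (X_ge0 _ om)) ->.
by rewrite /digit_of valK.
Qed.

Let key_measurable s n c : measurable (key s n @^-1` [set c]).
Proof.
rewrite key_preimage; apply: fin_bigcap_measurable => // i _.
by apply: measurable_sfunP; exact: slot_measurable.
Qed.

(** The argument of F takes finitely many values, each on a measurable event. *)
Lemma coarse_measurable (F : (I -> R) -> R) s n :
  measurable_fun setT (fun om => F (coarse s n (X ^~ om))).
Proof.
move=> _ B mB; rewrite setTI.
pose E c := if F (@decode s n c) \in B then [set: Omega] else set0.
have [] := @probability_partition _ _ _ P _ (key s n) E 1%E.
- by [].
- exact: key_measurable.
- by move=> c; rewrite /E; case: ifP.
- move=> c; rewrite mul1e; apply: le_measure; rewrite ?inE; last exact: subIsetl.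
    by apply: measurableI; [exact: key_measurable|rewrite /E; case: ifP].
  exact: key_measurable.
move=> + _; congr measurable; apply/seteqP; split => om /=; rewrite /E coarse_decode.
  by case: ifPn => //; rewrite inE.
by move=> FB; rewrite mem_set.
Qed.

(** Given the cell of the rounded variables, X i0 still has its own law, and the
    set B becomes a fixed one. *)
Lemma coarse_independent s n i0 (B : (I -> R) -> set R) (b : R) : 0 <= b ->
  uniq s -> i0 \notin s -> (forall w, measurable (B w)) ->
  (forall w, (P (X i0 @^-1` B w) <= b%:E)%E) ->
  measurable [set om | B (coarse s n (X ^~ om)) (X i0 om)] /\
  (P [set om | B (coarse s n (X ^~ om)) (X i0 om)] <= b%:E)%E.
Proof.
move=> b0 us i0s mB Bb.
have mXB w : measurable (X i0 @^-1` B w) by apply: measurable_sfunP.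
have -> : [set om | B (coarse s n (X ^~ om)) (X i0 om)] =
    [set om | (X i0 @^-1` B (decode (key s n om))) om].
  by apply/seteqP; split => om; rewrite /= coarse_decode.
apply: (@probability_partition _ _ _ P _ (key s n)
    (fun c => X i0 @^-1` B (decode c))) => //; first exact: key_measurable.
move=> c.
pose A i := if i == i0 then B (decode c) else slot n (digit_of c i).
have mA i : measurable (A i) by rewrite /A; case: ifP => _ //; exact: slot_measurable.
have AE i : i \in s -> A i = slot n (digit_of c i).
  by move=> is_; rewrite /A ifN//; apply: contraNneq i0s => <-.
have cellE : key s n @^-1` [set c] `&` X i0 @^-1` B (decode c) =
    \bigcap_(i in [set` i0 :: s]) X i @^-1` A i.
  rewrite key_preimage; apply/seteqP; split => [om [cell B0] i /=|om cell].
    rewrite inE => /predU1P[->|is_]; first by rewrite /A eqxx.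
    by rewrite /preimage /= AE//; exact: cell.
  split => [i /= is_|].
    by have := cell i; rewrite /= inE is_ orbT AE//; apply.
  by have := cell i0; rewrite /= inE eqxx /A eqxx; apply.
rewrite /= cellE X_indep//=; last by rewrite i0s.
rewrite big_cons {1}/A eqxx key_preimage X_indep//; last first.
  by move=> i; exact: slot_measurable.
rewrite lee_pmul//.
  by apply: prode_ge0.
rewrite le_eqVlt; apply/orP; left; apply/eqP.
by rewrite [LHS]big_seq [RHS]big_seq; apply: eq_bigr => i is_; rewrite AE.
Qed.

End discretization.

Section uniform.
Context {R : realType} {dO : measure_display} {Omega : measurableType dO}
  (P : probability Omega R) (X : {RV P >-> R}).
Hypothesis X_unif : uniform01 X.

Lemma uniform_unit_interval (A : set R) : measurable A -> A `<=` `[0, 1] ->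
  P (X @^-1` A) = lebesgue_measure A.
Proof.
move=> mA A01; have [_ /(_ A mA)] := X_unif.
rewrite /distribution /pushforward => ->; rewrite /uniform_prob.
rewrite (eq_integral (cst 1%E)) ?integral_cst ?mul1e//.
move=> x; rewrite inE => /A01 /=; rewrite in_itv/= /uniform_pdf => ->.
by rewrite subr0 invr1.
Qed.

Lemma uniform_le (A : set R) : measurable A ->
  (P (X @^-1` A) <= lebesgue_measure A)%E.
Proof.
move=> mA; have mA1 : measurable (A `&` `[0, 1]) by exact: measurableI.
apply: (@le_trans _ _ (lebesgue_measure (A `&` `[0, 1]))); last first.
  by apply: le_measure; rewrite ?inE//; exact: subIsetl.
rewrite -(uniform_unit_interval mA1 (@subIsetr _ _ _)).
rewrite le_eqVlt; apply/orP; left; apply/eqP; congr (P _).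
apply/seteqP; split => [om Ax|om []//]; split => //.
have /andP[X0 X1] := X_unif.1 om.
by rewrite /= in_itv/= (ltW X0).
Qed.

Lemma uniform_near (y e : R) : 0 <= e ->
  (P (X @^-1` [set x | (`|x - y| < e)%R]) <= (2 * e)%:E)%E.
Proof.
move=> e0; have -> : [set x | `|x - y| < e] = `]y - e, y + e[%classic.
  by apply/seteqP; split => x /=; rewrite in_itv/= ltr_distl.
apply: le_trans (uniform_le _) _ => //.
rewrite lebesgue_measure_itv/=; case: ifP => _; last by rewrite lee_fin mulr_ge0.
by rewrite -EFinD lee_fin; lra.
Qed.

Lemma uniform_gt_half : (P (X @^-1` [set x | (2^-1 < x)%R]) <= 2^-1%:E)%E.
Proof.
have -> : X @^-1` [set x | 2^-1 < x] = X @^-1` `]2^-1, 1]%classic.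
  apply/seteqP; split => om /=; rewrite in_itv/=; last by case/andP.
  by move=> ->; have /andP[_ ->] := X_unif.1 om.
apply: le_trans (uniform_le _) _ => //.
rewrite lebesgue_measure_itv/=; case: ifP => _; last by rewrite lee_fin.
by rewrite -EFinD lee_fin; lra.
Qed.

End uniform.

Section almost_surely.
Context {R : realType} {dO : measure_display} {Omega : measurableType dO}
  (P : probability Omega R).

(** A set covered by events of arbitrarily small probability need not be
    measurable to be negligible. *)
Lemma negligible_small (A : set Omega) :
  (forall n, exists B, [/\ measurable B, (P B <= (n.+1%:R^-1)%:E)%E & A `<=` B]) ->
  P.-negligible A.
Proof.
move=> /choice[B BP]; exists (\bigcap_n B n); split.
- by apply: bigcapT_measurable => n; have [] := BP n.
- apply/eqP; rewrite eq_le measure_ge0 andbT; apply/lee_addgt0Pr => e e0; rewrite add0e.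
  have [n ne] : exists n : nat, n.+1%:R^-1 <= e.
    by have /cvgr_le/(_ _ e0)/filter_ex[n ne] := @cvg_harmonic R; exists n.
  have [mB Bn _] := BP n.
  apply: (@le_trans _ _ (P (B n))).
    apply: le_measure; rewrite ?inE//; first by apply: bigcapT_measurable => k; have [] := BP k.
    by move=> x; apply.
  by rewrite (le_trans Bn)// lee_fin.
- by move=> x Ax n _; have [_ _] := BP n; apply.
Qed.

Context (I : countType) (X : I -> {RV P >-> R}).
Hypotheses (X_unif : forall i, uniform01 (X i)) (X_indep : mutually_independent X).

(** An atomless variable does not hit an independent one.  Y is only assumed to be
    a limit of functionals of rounded variables that leave i0 out: for each of
    these, the probability of being e-close to X i0 is at most 2 * e, and X i0 = Y
    forces e-closeness eventually. *)
Lemma almost_surely_neq (i0 : I) (s : nat -> seq I)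
    (F : nat -> (I -> R) -> R) (Y : Omega -> R) :
  (forall n, uniq (s n)) -> (forall n, i0 \notin s n) ->
  {ae P, forall om, F n (coarse (s n) n (X ^~ om)) @[n --> \oo] --> Y om} ->
  {ae P, forall om, X i0 om != Y om}.
Proof.
move=> us i0s [N [mN N0 cvN]].
suff : P.-negligible [set om | X i0 om = Y om /\
    (F n (coarse (s n) n (X ^~ om)) @[n --> \oo] --> Y om)].
  move=> neg; have negN : P.-negligible N by exact/negligibleP.
  apply: negligibleS (negligibleU neg negN) => om /= /negP; rewrite negbK => /eqP XY.
  by have [cvY|/cvN] := pselect (F n (coarse (s n) n (X ^~ om)) @[n --> \oo] --> Y om); [left|right].
apply: negligible_small => n.
pose e : R := (2 * n.+1%:R)^-1.
have e0 : 0 < e by rewrite invr_gt0 mulr_gt0.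
pose E k := [set om | `|X i0 om - F k (coarse (s k) k (X ^~ om))| < e].
have EP k : measurable (E k) /\ (P (E k) <= (n.+1%:R^-1)%:E)%E.
  have -> : n.+1%:R^-1 = 2 * e by rewrite /e invfM mulrA divff// mul1r.
  apply: (@coarse_independent _ _ _ P I X X_unif X_indep (s k) k i0
    (fun w => [set x | `|x - F k w| < e])) => //.
  - by rewrite mulr_ge0// ltW.
  - move=> w; have -> : [set x | `|x - F k w| < e] = `]F k w - e, F k w + e[%classic.
      by apply/seteqP; split => x /=; rewrite in_itv/= ltr_distl.
    exact: measurable_itv.
  - by move=> w; apply: (uniform_near (X_unif i0)); exact: ltW.
pose L m := \bigcap_(k in [set k | (m <= k)%N]) E k.
have mL m : measurable (L m).
  by apply: bigcap_measurable => [|k _]; [exists m => /=|have [] := EP k].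
exists (\bigcup_m L m); split.
- exact: bigcupT_measurable.
- have ndL : nondecreasing_seq L.
    by move=> a b ab; apply/subsetPset => om La k /= bk; apply: La; exact: leq_trans bk.
  have := nondecreasing_cvg_mu (mu := P) mL (bigcupT_measurable _ mL) ndL.
  move=> /cvge_to_le; apply; apply: nearW => m /=.
  have [mE PE] := EP m; apply: le_trans PE; apply: le_measure; rewrite ?inE//.
  by move=> om; apply; exact: leqnn.
- move=> om /= [XY cvY].
  have /cvgr_distC_lt/(_ _ e0) := cvY.
  move=> [m _ mP]; exists m => // k /= mk; rewrite /E /= XY distrC.
  exact: mP.
Qed.

(** The n.+1 draws following any rank m all exceed 1/2 with probability at most
    2 ^- n.+1. *)
Lemma infinitely_often_le_half (i_ : nat -> I) : injective i_ ->
  {ae P, forall om, forall m, exists2 k, (m <= k)%N & X (i_ k) om <= 2^-1}.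
Proof.
move=> inj_i; apply: ae_foralln => m.
pose H := [set x : R | 2^-1 < x].
have mH : measurable H.
  have -> : H = `]2^-1, +oo[%classic by apply/seteqP; split => x /=; rewrite in_itv/= ?andbT.
  exact: measurable_itv.
apply: negligible_small => n.
pose s := [seq i_ k | k <- iota m n.+1].
have us : uniq s by rewrite map_inj_uniq// iota_uniq.
exists (\bigcap_(i in [set` s]) X i @^-1` H); split.
- apply: fin_bigcap_measurable => // i _; exact: measurable_sfunP.
- rewrite X_indep//.
  apply: (@le_trans _ _ ((2^-1 ^+ n.+1 : R)%:E)).
    rewrite /s big_map; clear s us; elim: n.+1 m => [|l IHl] m' /=; first by rewrite big_nil expr0.
    rewrite big_cons exprS EFinM lee_pmul//; first by apply: prode_ge0.
    exact: (uniform_gt_half (X_unif _)).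
  rewrite lee_fin exprVn lef_pV2 ?posrE ?exprn_gt0//.
  by rewrite -natrX ler_nat ltnW// ltn_expl.
- move=> om /= noX i /mapP[k]; rewrite mem_iota => /andP[mk _] -> /=.
  by rewrite /H/= ltNge; apply/negP => Xk; apply: noX; exists k.
Qed.

End almost_surely.

(** * Almost every path is good *)

Section explosion.
Context {R : realType} {d N : nat} (D : switching R d N).
Implicit Types (i : 'I_N) (x : 'rV[R]_d) (u v : nat -> R) (z : K D).

(** Right-continuity of the finitely many G^i at 0, where they equal 1, together
    with the upper bound on the intensities. *)
Lemma uniform_survival : exists2 e : R, 0 < e &
  forall x i, 2^-1 < Gz D (x, 0, i) e.
Proof.
have [L L0 LP] := lambda_upper D.
have [h h0 hG] : exists2 h : R, 0 < h & forall i, 2^-1 < G D i h.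
  have near_half i : \forall h \near 0^'+, 2^-1 < G D i h.
    have := @survival_right_continuous _ _ _ D i 0.
    rewrite survival0 => /cvgr_gt; apply.
    by rewrite invf_lt1// ltr1n.
  have /(filterI (nbhs_right_gt 0))/filter_ex[h [h0 hG]] :
      \forall h \near 0^'+, forall i, 2^-1 < G D i h.
    exact: (@filter_forall _ _ (fun i h => 2^-1 < G D i h)).
  by exists h.
exists (h / L); first by rewrite divr_gt0.
move=> x i; rewrite /Gz hazard00 survival0 divr1.
apply: lt_le_trans (hG i) _; apply: survival_nonincreasing.
apply: le_trans (hazard_upper (LP i) _ _) _.
- exact: (life_gt0 (phi_flow D i) x).
- by rewrite oppr0 divr_ge0// ltW.
- by rewrite add0r mulrC divfK// gt_eqF.
Qed.

(** A draw at most 1/2 makes the process wait at least the time e of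
    [uniform_survival].  The draw u 1 is left aside: it acts on the initial state,
    whose age need not be 0. *)
Lemma jump_time_unbounded u v z : unit_seq u ->
  (forall m, exists2 k, (m <= k)%N & u k.+2 <= 2^-1) ->
  forall t, exists k, t < jump_time u v z k.
Proof.
move=> u01 io t; have [e e0 eG] := uniform_survival.
have step k : u k.+2 <= 2^-1 ->
    jump_time u v z k.+1 + e <= jump_time u v z k.+2.
  move=> uk; rewrite [leRHS]jump_timeS lerD2l; apply: ge_psi.
  - exact: post_jump_K.
  - by have /andP[] := u01 k.+2.
  - move=> r r0 Gr; rewrite leNgt; apply/negP => re.
    have := post_jump_K u v z k.+1; move: Gr; rewrite post_jumpS.
    set x := landing _ _ _; set i := next_index _ _ _ _ => Gr Kx.
    have := le_trans (Gz_nonincreasing Kx (ltW re)) (le_trans Gr uk).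
    by rewrite leNgt eG.
have grow m : exists k, m%:R * e <= jump_time u v z k.
  elim: m => [|m [k mk]]; first by exists 0%N; rewrite mul0r jump_time0.
  have [k' kk' uk'] := io k; exists k'.+2.
  apply: le_trans (step _ uk'); rewrite -natr1 mulrDl mul1r lerD2r (le_trans mk)//.
  by apply: jump_time_nondecreasing; rewrite leqW.
have [k kt] := grow (Num.truncn (`|t| / e)).+1.
exists k; apply: lt_le_trans kt; apply: le_lt_trans (ler_norm t) _.
by rewrite -ltr_pdivrMr// truncnS_gt.
Qed.

End explosion.

Section locality.
Context {R : realType} {d N : nat} (D : switching R d N).
Implicit Types (u v : nat -> R) (z : K D).

Lemma skeleton_local u v u' v' z k :
  (forall l, (l < k)%N -> u l.+1 = u' l.+1) ->
  (forall l, (l < k)%N -> v l.+1 = v' l.+1) ->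
  jump_time u v z k = jump_time u' v' z k /\
  post_jump u v z k = post_jump u' v' z k.
Proof.
elim: k => [//|k IHk] uu vv.
have [|l lk|Tk Zk] := IHk; [by move=> l lk; apply: uu; rewrite ltnW|by apply: vv; rewrite ltnW|].
by rewrite !jump_timeS !post_jumpS Tk Zk uu// vv.
Qed.

Hypothesis G_continuous : forall i, {within `[0, +oo[, continuous (G D i)}.
Local Notation space := ('rV[R]_d * R * discrete_topology 'I_N)%type.

Lemma landing_cvg (w_ : nat -> space) (u_ : nat -> R) (w : space) (a : R) :
  (forall n, K D (w_ n)) -> K D w -> w_ @ \oo --> w -> u_ @ \oo --> a ->
  (forall n, 0 < u_ n) -> 0 < a ->
  (forall q : rat, 0 <= q -> Gz D w (ratr q) != a) ->
  landing D (w_ n) (u_ n) @[n --> \oo] --> landing D w a.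
Proof.
move=> Kw_ Kw ww uu u0 a0 aG.
have psic := psi_cvg G_continuous Kw_ Kw ww uu u0 a0 aG.
have flc : flow D (w_ n) (psi D (w_ n) (u_ n)) @[n --> \oo] -->
    flow D w (psi D w a).
  by apply: flow_space_cvg => //; exact: psi_ge0.
have /cvg_space[/= + _ _] := flc.
have flow1 (y : space) r : (flow D y r).1.1 = phi D y.2 r y.1.1 by case: y => -[].
by rewrite flow1; under eq_fun do rewrite flow1.
Qed.

End locality.

Section goodness.
Context {R : realType} {d N : nat} (D : switching R d N)
  {dO : measure_display} {Omega : measurableType dO}
  (P : probability Omega R) (U V : nat -> {RV P >-> R}).
Hypothesis UV_iid : iid_uniform_pair U V.
Hypothesis G_continuous : forall i, {within `[0, +oo[, continuous (G D i)}.
Implicit Types (z : K D) (om : Omega) (t : R) (n k : nat).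

Definition draw (i : nat + nat) : {RV P >-> R} :=
  match i with inl k => U k | inr k => V k end.

Lemma draw_unif i : uniform01 (draw i).
Proof. by have [Uu Vu _] := UV_iid; case: i => k; [exact: Uu|exact: Vu]. Qed.

Lemma draw_indep : mutually_independent draw. Proof. by have [] := UV_iid. Qed.

Lemma U_unit om : unit_seq (U ^~ om).
Proof. by move=> k; exact: (draw_unif (inl k)).1. Qed.

Lemma V_unit om : unit_seq (V ^~ om).
Proof. by move=> k; exact: (draw_unif (inr k)).1. Qed.

(** Enumerating both families by the standard numbering of nat + nat, so that every
    draw is eventually taken into account. *)
Definition first_draws n : seq (nat + nat) := pmap (@pickle_inv _) (iota 0 n.+1).

Lemma first_drawsP n i : (i \in first_draws n) = (pickle i <= n)%N.
Proof.
rewrite /first_draws mem_pmap; apply/mapP/idP => [[k]|ni].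
  rewrite mem_iota add0n ltnS => kn; rewrite /pickle_inv.
  case: unpickle => //= j; case: eqP => //= jk [->]; by rewrite jk.
by exists (pickle i); rewrite ?mem_iota ?pickleK_inv.
Qed.

Lemma first_draws_uniq n : uniq (first_draws n).
Proof. by apply: (pmap_uniq (@pickle_invK _)); exact: iota_uniq. Qed.

(** The coordinate i0 is masked by the value that [coarse] gives to the draws it
    ignores. *)
Definition hidden (w : nat + nat -> R) i0 i : R := if i == i0 then 1 else w i.

Lemma coarse_cvg om i :
  coarse (first_draws n) n (draw ^~ om) i @[n --> \oo] --> draw i om.
Proof.
apply: (@cvg_trans _ (level n (draw i om) @[n --> \oo])).
  apply: near_eq_cvg; near=> n; rewrite /coarse first_drawsP ifT//.
  by near: n; exact: nbhs_infty_ge.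
by apply: level_cvg; exact: (draw_unif i).1.
Unshelve. all: by end_near. Qed.

Lemma coarse_hidden_cvg om i0 i :
  coarse (rem i0 (first_draws n)) n (draw ^~ om) i @[n --> \oo] -->
  hidden (draw ^~ om) i0 i.
Proof.
have memE n : (i \in rem i0 (first_draws n)) = (i != i0) && (i \in first_draws n).
  by rewrite (mem_rem_uniq _ (first_draws_uniq n)) inE.
rewrite /hidden; case: eqP => [ii0|/eqP ii0].
  by under eq_fun do rewrite /coarse memE ii0 eqxx; exact: cvg_cst.
apply: cvg_trans (@coarse_cvg om i); apply: near_eq_cvg.
by apply: nearW => n; rewrite /coarse memE ii0.
Qed.

Lemma coarse_unit s n om i : 0 < coarse s n (draw ^~ om) i <= 1.
Proof.
by rewrite /coarse; case: ifP => _; rewrite ?ltr01 ?lexx// level_unit// (draw_unif i).1.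
Qed.

Lemma ae_draw_neq i0 (F : (nat + nat -> R) -> R) (Y : Omega -> R) :
  {ae P, forall om, F (coarse (rem i0 (first_draws n)) n (draw ^~ om)) @[n --> \oo] --> Y om} ->
  {ae P, forall om, draw i0 om != Y om}.
Proof.
apply: (almost_surely_neq draw_unif draw_indep (F := fun=> F)).
- by move=> n; rewrite rem_uniq// first_draws_uniq.
- by move=> n; rewrite (mem_rem_uniq _ (first_draws_uniq n)) !inE eqxx.
Qed.

End goodness.

Section almost_sure_goodness.
Context {R : realType} {d N : nat} (D : switching R d N)
  {dO : measure_display} {Omega : measurableType dO}
  (P : probability Omega R) (U V : nat -> {RV P >-> R}).
Hypothesis UV_iid : iid_uniform_pair U V.
Hypothesis G_continuous : forall i, {within `[0, +oo[, continuous (G D i)}.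
Local Notation space := ('rV[R]_d * R * discrete_topology 'I_N)%type.
Implicit Types (z : K D) (om : Omega) (t : R) (n k : nat) (w : nat + nat -> R).

Let draws := draw U V.
Let fst_draw w (l : nat) : R := w (inl l).
Let snd_draw w (l : nat) : R := w (inr l).

Definition good_until z k om := forall l, (l < k)%N ->
  good_step D (post_jump (U ^~ om) (V ^~ om) z l) (U l.+1 om) (V l.+1 om).

(* what remains visible at stage n when the draw i0 is masked *)
Let view i0 om n : nat + nat -> R :=
  coarse (rem i0 (first_draws n)) n (draws ^~ om).

(** Masking a draw that comes after the first k jumps does not affect them, so they
    can be recovered in the limit without it. *)
Lemma view_skeleton_cvg z k om i0 :
  (forall l, (l < k)%N -> i0 != inl l.+1 /\ i0 != inr l.+1) ->
  good_until z k om ->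
  jump_time (fst_draw (view i0 om n)) (snd_draw (view i0 om n)) z k @[n --> \oo]
    --> jump_time (U ^~ om) (V ^~ om) z k /\
  post_jump (fst_draw (view i0 om n)) (snd_draw (view i0 om n)) z k @[n --> \oo]
    --> post_jump (U ^~ om) (V ^~ om) z k.
Proof.
move=> i0k good; pose w := hidden (draws ^~ om) i0.
have w01 i : 0 < w i <= 1.
  by rewrite /w /hidden; case: ifP => _; rewrite ?ltr01 ?lexx//; exact: (draw_unif UV_iid i).1.
have uw l : (l < k)%N -> fst_draw w l.+1 = U l.+1 om.
  by move=> /i0k[/negPf i0l _]; rewrite /fst_draw /w /hidden eq_sym i0l.
have vw l : (l < k)%N -> snd_draw w l.+1 = V l.+1 om.
  by move=> /i0k[_ /negPf i0l]; rewrite /snd_draw /w /hidden eq_sym i0l.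
have [<- <-] := @skeleton_local _ _ _ D _ _ (U ^~ om) (V ^~ om) z _ uw vw.
apply: (@skeleton_cvg _ _ _ D G_continuous (fun n => fst_draw (view i0 om n))
  (fun n => snd_draw (view i0 om n)) (fun=> z)).
- by move=> n l; exact: (coarse_unit UV_iid).
- by move=> l; exact: w01.
- by move=> l; exact: w01.
- by move=> l; exact: coarse_hidden_cvg.
- by move=> l; exact: coarse_hidden_cvg.
- exact: cvg_cst.
- move=> l lk; have lk' m : (m < l)%N -> (m < k)%N by move=> /ltn_trans; apply.
  have [_ ->] := @skeleton_local _ _ _ D _ _ (U ^~ om) (V ^~ om) z _ (fun m ml => uw m (lk' m ml)) (fun m ml => vw m (lk' m ml)).
  by rewrite uw// vw//; exact: good.
Qed.

(** Two instances matter: b = 0 gives the survival function at a fixed time c, and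
    b = 1 gives it at the time remaining until c. *)
Lemma ae_survival_neq z k (b c : R) : {ae P, forall om, good_until z k om} ->
  {ae P, forall om, Gz D (post_jump (U ^~ om) (V ^~ om) z k)
    (c - b * jump_time (U ^~ om) (V ^~ om) z k) != U k.+1 om}.
Proof.
move=> good; pose F w := Gz D (post_jump (fst_draw w) (snd_draw w) z k)
  (c - b * jump_time (fst_draw w) (snd_draw w) z k).
have : {ae P, forall om, draws (inl k.+1) om !=
    Gz D (post_jump (U ^~ om) (V ^~ om) z k)
      (c - b * jump_time (U ^~ om) (V ^~ om) z k)}.
  apply: (ae_draw_neq UV_iid (F := F)); apply: filterS good => om good.
  have [|Tk Zk] := @view_skeleton_cvg z k om (inl k.+1) _ good.
    by move=> l lk; split => //; apply: contraTneq lk => -[->]; rewrite ltnn.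
  apply: (Gz_cvg G_continuous) => //.
  - by move=> n; exact: post_jump_K.
  - exact: post_jump_K.
  - by apply: cvgB; [exact: cvg_cst|apply: cvgM => //; exact: cvg_cst].
by apply: filterS => om; rewrite eq_sym.
Qed.

Lemma ae_rational_survival_neq z k : {ae P, forall om, good_until z k om} ->
  {ae P, forall om, forall q : rat, 0 <= q ->
    Gz D (post_jump (U ^~ om) (V ^~ om) z k) (ratr q) != U k.+1 om}.
Proof.
move=> good.
have : {ae P, forall om, forall m : nat,
    if @unpickle rat m is Some q then
      Gz D (post_jump (U ^~ om) (V ^~ om) z k) (ratr q) != U k.+1 om else true}.
  apply: ae_foralln => m; case: unpickle => [q|]; last by apply: aeW.
  have := @ae_survival_neq z k 0 (ratr q) good.
  by apply: filterS => om; rewrite mul0r subr0.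
by apply: filterS => om H q _; have := H (pickle q); rewrite pickleK.
Qed.

Lemma ae_index_neq z k : {ae P, forall om, good_until z k om} ->
  {ae P, forall om, forall j,
    cumQ D (landing D (post_jump (U ^~ om) (V ^~ om) z k) (U k.+1 om))
      (post_jump (U ^~ om) (V ^~ om) z k).2 j != V k.+1 om}.
Proof.
move=> good; have goodG := ae_rational_survival_neq good.
apply: (@filter_forall _ _ (fun j om =>
  cumQ D (landing D (post_jump (U ^~ om) (V ^~ om) z k) (U k.+1 om))
      (post_jump (U ^~ om) (V ^~ om) z k).2 j != V k.+1 om)) => j.
pose F w := let y := post_jump (fst_draw w) (snd_draw w) z k in
  cumQ D (landing D y (fst_draw w k.+1)) y.2 j.
have : {ae P, forall om, draws (inr k.+1) om !=
    cumQ D (landing D (post_jump (U ^~ om) (V ^~ om) z k) (U k.+1 om))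
      (post_jump (U ^~ om) (V ^~ om) z k).2 j}.
  apply: (ae_draw_neq UV_iid (F := F)); apply: filterS2 good goodG => om good goodG.
  have [|Tk Zk] := @view_skeleton_cvg z k om (inr k.+1) _ good.
    by move=> l lk; split => //; apply: contraTneq lk => -[->]; rewrite ltnn.
  have lk : landing D (post_jump (fst_draw (view (inr k.+1) om n))
      (snd_draw (view (inr k.+1) om n)) z k) (fst_draw (view (inr k.+1) om n) k.+1)
      @[n --> \oo] --> landing D (post_jump (U ^~ om) (V ^~ om) z k) (U k.+1 om).
    apply: (landing_cvg G_continuous) => //.
    - by move=> n; exact: post_jump_K.
    - exact: post_jump_K.
    - exact: (@coarse_hidden_cvg _ _ _ _ _ _ UV_iid om (inr k.+1) (inl k.+1)).
    - by move=> n; have /andP[] := coarse_unit UV_iid (rem (inr k.+1) (first_draws n)) n om (inl k.+1).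
    - by have /andP[] := (draw_unif UV_iid (inl k.+1)).1 om.
  have /cvg_space[_ _ ik] := Zk.
  apply: (@cvg_trans _ (cumQ D (landing D (post_jump (fst_draw (view (inr k.+1) om n))
      (snd_draw (view (inr k.+1) om n)) z k) (fst_draw (view (inr k.+1) om n) k.+1))
      (post_jump (U ^~ om) (V ^~ om) z k).2 j @[n --> \oo])).
    by apply: near_eq_cvg; apply: filterS ik => n ikn; rewrite /F ikn.
  exact: cumQ_cvg.
by apply: filterS => om; rewrite eq_sym.
Qed.

Lemma ae_good_until z k : {ae P, forall om, good_until z k om}.
Proof.
elim: k => [|k IHk]; first by apply: aeW => om l.
apply: filterS3 IHk (ae_rational_survival_neq IHk) (ae_index_neq IHk) => om good gG gQ l.
by rewrite ltnS leq_eqVlt => /predU1P[->|/good]; first by split.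
Qed.

Lemma ae_good_path z t :
  {ae P, forall om, good_path (U ^~ om) (V ^~ om) z t}.
Proof.
have good : {ae P, forall om, forall k, good_until z k om}.
  by apply: ae_foralln => k; exact: ae_good_until.
have goodt : {ae P, forall om, forall k,
    Gz D (post_jump (U ^~ om) (V ^~ om) z k)
      (t - jump_time (U ^~ om) (V ^~ om) z k) != U k.+1 om}.
  apply: ae_foralln => k; have := @ae_survival_neq z k 1 t (ae_good_until z k).
  by apply: filterS => om; rewrite mul1r.
have io : {ae P, forall om, forall m, exists2 k, (m <= k)%N &
    draws (inl k.+2) om <= 2^-1}.
  apply: (infinitely_often_le_half (draw_unif UV_iid) (draw_indep UV_iid)
    (i_ := fun k => inl k.+2)).
  by move=> k l [].
apply: filterS3 good goodt io => om good goodt io; split => //.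
- by move=> k; exact: (good k.+1).
- exact: (jump_time_unbounded _ _ (U_unit UV_iid om) io).
Qed.

End almost_sure_goodness.

(** * Integrals of possibly non-measurable functions *)

Section lower_integral.
Local Open Scope ereal_scope.
Context {d} {T : measurableType d} {R : realType}
  (mu : {measure set T -> \bar R}).
Implicit Types (f g : T -> \bar R).
Import HBNNSimple.

(** The integral of a nonnegative function is the supremum over the simple
    functions below it, hence monotone on arbitrary functions. *)
Lemma lower_integral_le f g : (forall x, 0 <= f x) -> (forall x, f x <= g x) ->
  \int[mu]_x f x <= \int[mu]_x g x.
Proof.
move=> f0 fg; have g0 x : 0 <= g x by exact: le_trans (fg x).
rewrite !ge0_integralTE//; apply: ge_ereal_sup => _ [h /= hf <-].
by apply: ereal_sup_ubound; exists h => // x; exact: le_trans (fg x).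
Qed.

Lemma lower_integral_ub f b : (forall x, 0 <= f x) ->
  (forall h : {nnsfun T >-> R}, (forall x, (h x)%:E <= f x) ->
    \int[mu]_x (h x)%:E <= b) ->
  \int[mu]_x f x <= b.
Proof.
move=> f0 hb; rewrite ge0_integralTE//; apply: ge_ereal_sup => _ [h /= hf <-].
by rewrite -integralT_nnsfun; exact: hb.
Qed.

Let ge0_lower_integral_off_null f g (N : set T) : measurable N -> mu N = 0 ->
  (forall x, 0 <= f x) -> (forall x, 0 <= g x) ->
  (forall x, ~ N x -> f x = g x) -> \int[mu]_x f x <= \int[mu]_x g x.
Proof.
move=> mN N0 f0 g0 fg; apply: lower_integral_ub => // h hf.
have mh : measurable_fun setT (fun x => (h x)%:E).
  by apply/measurable_EFinP; exact: measurable_funP.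
have h0 x : 0 <= (h x)%:E by rewrite lee_fin.
rewrite (@ge0_negligible_integral _ _ _ mu setT N)//.
rewrite setTD integral_mkcond; apply: lower_integral_le => x; rewrite /patch.
  by case: ifP.
by case: ifPn => [|_ //]; rewrite inE/= => Nx; rewrite -fg.
Qed.

Lemma lower_integral_off_null f g (N : set T) : measurable N -> mu N = 0 ->
  (forall x, ~ N x -> f x = g x) -> \int[mu]_x f x = \int[mu]_x g x.
Proof.
move=> mN N0 fg; rewrite [LHS]integralE [RHS]integralE.
by congr (_ - _); apply/eqP; rewrite eq_le; apply/andP; split;
  apply: (ge0_lower_integral_off_null mN N0) => // x Nx;
  by rewrite ?funeposE ?funenegE fg.
Qed.

End lower_integral.

Section bounded_convergence.
Context {d} {T : measurableType d} {R : realType} (P : probability T R).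
Implicit Types (f : T -> R) (M : R).

(** The probability space is not assumed complete, so an almost sure limit of
    measurable functions is only equal to a measurable one off a null event. *)
Definition ae_measurable f := exists g : T -> R, exists N : set T,
  [/\ measurable_fun setT g, measurable N, P N = 0%E & forall x, ~ N x -> f x = g x].

Lemma ae_limit_measurable (f_ : nat -> T -> R) f :
  (forall n, measurable_fun setT (f_ n)) ->
  {ae P, forall x, f_ n x @[n --> \oo] --> f x} -> ae_measurable f.
Proof.
move=> mf [N [mN N0 Nf]]; exists (f \_ (~` N)), N; split => //.
- have mNC : measurable (~` N) by exact: measurableC.
  apply/(measurable_restrictT _ mNC).
  apply: (@measurable_fun_cvg _ _ _ (~` N) f_) => //.
    by move=> n; apply: measurable_funTS.
  by move=> x Nx; apply: contrapT => fx; apply: Nx; exact: Nf.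
- by move=> x Nx; rewrite /patch ifT// inE.
Qed.

Lemma expectationTE f : 'E_P[f]%E = (\int[P]_x (f x)%:E)%E.
Proof. by rewrite expectation.unlock. Qed.

Lemma bounded_ae_measurable f M : 0 <= M -> ae_measurable f ->
  (forall x, `|f x| <= M) -> exists g : T -> R, [/\ measurable_fun setT g,
    forall x, `|g x| <= M, {ae P, forall x, f x = g x} & 'E_P[f]%E = 'E_P[g]%E].
Proof.
move=> M0 [g [N [mg mN N0 fg]]] fM; have mNC : measurable (~` N) by exact: measurableC.
exists (g \_ (~` N)); split.
- by apply/(measurable_restrictT _ mNC); exact: measurable_funTS.
- move=> x; rewrite /patch; case: ifPn => [|_]; last by rewrite normr0.
  by rewrite inE => Nx; rewrite -fg.
- by exists N; split => // x /= fgN; apply: contrapT => Nx; apply: fgN; rewrite /patch ifT ?inE ?fg.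
- rewrite !expectationTE; apply: (lower_integral_off_null mN N0) => x Nx.
  by rewrite /patch ifT ?inE ?fg.
Qed.

Lemma bounded_fin_num f M : 0 <= M -> ae_measurable f ->
  (forall x, `|f x| <= M) -> 'E_P[f]%E \is a fin_num.
Proof.
move=> M0 mf fM; have [g [mg gM _ ->]] := bounded_ae_measurable M0 mf fM.
rewrite expectationTE; apply: integrable_fin_num => //.
apply: (le_integrable measurableT _ _ (finite_measure_integrable_cst P M measurableT)).
  exact/measurable_EFinP.
by move=> x _ /=; rewrite lee_fin (ger0_norm M0).
Qed.

Lemma bounded_convergence (f_ : nat -> T -> R) f M : 0 <= M ->
  (forall n, ae_measurable (f_ n)) -> ae_measurable f ->
  (forall n x, `|f_ n x| <= M) -> (forall x, `|f x| <= M) ->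
  {ae P, forall x, f_ n x @[n --> \oo] --> f x} ->
  fine 'E_P[f_ n] @[n --> \oo] --> fine 'E_P[f].
Proof.
move=> M0 mf_ mf f_M fM ff.
apply: fine_cvg; rewrite fineK ?(bounded_fin_num M0)//.
have [g [mg gM fg ->]] := bounded_ae_measurable M0 mf fM.
have /choice[g_ g_P] : forall n, exists g : T -> R, [/\ measurable_fun setT g,
    forall x, `|g x| <= M, {ae P, forall x, f_ n x = g x} & 'E_P[f_ n]%E = 'E_P[g]%E].
  by move=> n; exact: bounded_ae_measurable.
have -> : (fun n => 'E_P[f_ n]%E) = (fun n => \int[P]_x (g_ n x)%:E)%E.
  by apply/funext => n; have [_ _ _ ->] := g_P n; rewrite expectationTE.
rewrite expectationTE.
have fg_ : {ae P, forall x, forall n, f_ n x = g_ n x}.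
  by apply: ae_foralln => n; have [] := g_P n.
have [] := @dominated_convergence _ _ _ P setT measurableT (fun n x => (g_ n x)%:E)
  (EFin \o g) (EFin \o cst M) => //.
- by move=> n; apply/measurable_EFinP; have [] := g_P n.
- exact/measurable_EFinP.
- apply: filterS3 ff fg fg_ => x fx fgx gx _; rewrite /= -fgx; apply: cvg_EFin; first exact: nearW.
  by apply: cvg_trans fx; apply: near_eq_cvg; apply: nearW => n /=; rewrite gx.
- exact: finite_measure_integrable_cst.
- by apply: aeW => x n _; rewrite lee_fin; have [_ + _ _] := g_P n; exact.
Qed.

Lemma expectation_bounded f M : 0 <= M -> ae_measurable f ->
  (forall x, `|f x| <= M) -> `|fine 'E_P[f]| <= M.
Proof.
move=> M0 mf fM; have fin := bounded_fin_num M0 mf fM.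
have [g [mg gM _ Eg]] := bounded_ae_measurable M0 mf fM.
rewrite -lee_fin -fine_abse// fineK ?abse_fin_num// Eg expectationTE.
have mgE : measurable_fun setT (EFin \o g) by exact/measurable_EFinP.
apply: le_trans (le_abse_integral P measurableT mgE) _.
apply: (@le_trans _ _ (\int[P]_x (cst M%:E x))%E).
  by apply: lower_integral_le => x //=; rewrite lee_fin.
by rewrite integral_cst//= [X in (_ * X)%E](probability_setT P) mule1.
Qed.

End bounded_convergence.

(** * Sufficiency of the continuity of the survival functions *)

Section feller.
Context {R : realType} {d N : nat} (D : switching R d N)
  {dO : measure_display} {Omega : measurableType dO}
  (P : probability Omega R) (U V : nat -> {RV P >-> R}).
Hypothesis UV_iid : iid_uniform_pair U V.
Hypothesis G_continuous : forall i, {within `[0, +oo[, continuous (G D i)}.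
Local Notation space := ('rV[R]_d * R * discrete_topology 'I_N)%type.
Implicit Types (z : K D) (t : R).

(** K carries the initial topology of its inclusion. *)
Lemma continuous_K_cvg (f : K D -> R) (y_ : nat -> K D) (y : K D) :
  continuous f -> val (y_ n) @[n --> \oo] --> val y ->
  f (y_ n) @[n --> \oo] --> f y.
Proof.
move=> cf yy; apply: cvg_comp (cf y) => A.
rewrite nbhsE => -[W [[B oB <-] /= By] BA].
have : \forall n \near \oo, B (val (y_ n)) by apply: yy; exact: open_nbhs_nbhs.
by apply: filterS => n Bn; exact: BA.
Qed.

Variables (f : K D -> R) (M : R).
Hypotheses (f_cont : continuous f) (M0 : 0 <= M) (fM : forall z, `|f z| <= M).

Let value z t (om : Omega) : R := f (state_at (U ^~ om) (V ^~ om) z t).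

Let value_ae_measurable z t : 0 <= t -> ae_measurable P (value z t).
Proof.
move=> t0; pose F (w : nat + nat -> R) :=
  f (state_at (fun l => w (inl l)) (fun l => w (inr l)) z t).
apply: (@ae_limit_measurable _ _ _ P
  (fun n om => F (coarse (first_draws n) n (draw U V ^~ om)))).
  by move=> n; apply: coarse_measurable; exact: draw_unif.
apply: filterS (ae_good_path UV_iid G_continuous z t) => om good.
apply: continuous_K_cvg => //.
apply: (@state_at_cvg _ _ _ D G_continuous _ _ (fun=> z) (fun=> t)) good => //.
- by move=> n l; exact: (coarse_unit UV_iid).
- exact: (U_unit UV_iid).
- exact: (V_unit UV_iid).
- by move=> l; exact: coarse_cvg.
- by move=> l; exact: coarse_cvg.
- exact: cvg_cst.
- exact: cvg_cst.
Qed.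

Let value_cvg (z_ : nat -> K D) (t_ : nat -> R) z t :
  (forall n, 0 <= t_ n) -> 0 <= t -> t_ @ \oo --> t ->
  val (z_ n) @[n --> \oo] --> val z ->
  fine 'E_P[value (z_ n) (t_ n)] @[n --> \oo] --> fine 'E_P[value z t].
Proof.
move=> t_0 t0 tt zz; apply: (bounded_convergence (M := M)) => //.
- by move=> n; exact: value_ae_measurable.
- exact: value_ae_measurable.
- by move=> n om; exact: fM.
- by move=> om; exact: fM.
apply: filterS (ae_good_path UV_iid G_continuous z t) => om good.
apply: continuous_K_cvg => //.
apply: (@state_at_cvg _ _ _ D G_continuous (fun=> U ^~ om) (fun=> V ^~ om)) good => //.
- by move=> n; exact: (U_unit UV_iid).
- exact: (U_unit UV_iid).
- exact: (V_unit UV_iid).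
- by move=> l; exact: cvg_cst.
- by move=> l; exact: cvg_cst.
Qed.

Lemma semigroup_bounded z t : 0 <= t -> `|semigroup D U V t f z| <= M.
Proof.
by move=> t0; apply: expectation_bounded => //; exact: value_ae_measurable.
Qed.

(** The domain is first countable: were continuity to fail, a sequence chosen at
    distance less than n.+1^-1 would contradict bounded convergence. *)
Lemma semigroup_continuous :
  {within [set p : R * K D | 0 <= p.1],
    continuous (fun p => semigroup D U V p.1 f p.2)}.
Proof.
apply/subspace_continuousP => -[t z] /= t0; apply/cvgrPdist_lt => e e0.
set A := [set p : R * K D | 0 <= p.1].
pose h (p : R * K D) := semigroup D U V p.1 f p.2.
suff : \forall p \near within A (nbhs (t, z)), `|semigroup D U V t f z - h p| < e by [].
apply: contrapT => far.
pose close (n : nat) (p : R * K D) := [/\ `|p.1 - t| < n.+1%:R^-1,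
  `|(val p.2).1.1 - (val z).1.1| < n.+1%:R^-1,
  `|(val p.2).1.2 - (val z).1.2| < n.+1%:R^-1 & (val p.2).2 = (val z).2].
have near_close n : \forall p \near within A (nbhs (t, z)), close n p.
  have pt : p.1 @[p --> within A (nbhs (t, z))] --> t.
    move=> B tB; apply: (@cvg_within _ (nbhs (t, z)) _ A (fst @^-1` B)).
    exact: (@cvg_fst _ _ (nbhs t) (nbhs z) _ B tB).
  have vz : val p.2 @[p --> within A (nbhs (t, z))] --> val z.
    apply: (@cvg_comp _ _ _ snd val _ (nbhs z)).
      move=> B zB; apply: (@cvg_within _ (nbhs (t, z)) _ A (snd @^-1` B)).
      exact: (@cvg_snd _ _ (nbhs t) (nbhs z) _ B zB).
    exact: (@initial_continuous _ _ (set_val : K D -> space) z).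
  have vz1 : (val p.2).1 @[p --> within A (nbhs (t, z))] --> (val z).1.
    exact: cvg_comp vz cvg_fst.
  have nx : \forall p \near within A (nbhs (t, z)), `|(val p.2).1.1 - (val z).1.1| < n.+1%:R^-1.
    have /cvgrPdistC_lt : (val p.2).1.1 @[p --> within A (nbhs (t, z))] --> (val z).1.1.
      exact: cvg_comp vz1 cvg_fst.
    by apply; rewrite invr_gt0.
  have ns : \forall p \near within A (nbhs (t, z)), `|(val p.2).1.2 - (val z).1.2| < n.+1%:R^-1.
    have /cvgrPdistC_lt : (val p.2).1.2 @[p --> within A (nbhs (t, z))] --> (val z).1.2.
      exact: cvg_comp vz1 cvg_snd.
    by apply; rewrite invr_gt0.
  have nt : \forall p \near within A (nbhs (t, z)), `|p.1 - t| < n.+1%:R^-1.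
    by move/cvgrPdistC_lt : pt; apply; rewrite invr_gt0.
  have ni : \forall p \near within A (nbhs (t, z)), (val p.2).2 = (val z).2.
    have : (val p.2).2 @[p --> within A (nbhs (t, z))] --> (val z).2.
      exact: cvg_comp vz cvg_snd.
    move=> /(_ [set (val z).2]); apply.
    by rewrite nbhs_principalE; apply/principal_filterP.
  by apply: filterS3 nt (filterI nx ns) ni => p ? [].
have /choice[p_ p_P] : forall n, exists p,
    [/\ 0 <= p.1, close n p & e <= `|semigroup D U V t f z - h p|].
  move=> n; apply: contrapT => nop; apply: far.
  near=> p; rewrite ltNge; apply/negP => ep; apply: nop; exists p; split => //.
  - by near: p; apply: withinT.
  - by near: p.
have small (V' : normedModType R) (g : nat -> V') (l : V') :
    (forall n, `|g n - l| < n.+1%:R^-1) -> g @ \oo --> l.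
  move=> gl; apply/cvgrPdistC_le => r r0; near=> n.
  apply: (le_trans (ltW (gl n))); near: n.
  by have /cvgr_le/(_ _ r0) := @cvg_harmonic R.
have : h (p_ n) @[n --> \oo] --> semigroup D U V t f z.
  apply: value_cvg => //.
  - by move=> n; have [] := p_P n.
  - by apply: small => n; have [_ [] ] := p_P n.
  - apply/cvg_space; split.
    + by apply: small => n; have [_ [] ] := p_P n.
    + by apply: (small R) => n; have [_ [] ] := p_P n.
    + by apply: nearW => n; have [_ [] ] := p_P n.
move=> /cvgrPdist_lt/(_ _ e0)/filter_ex[n].
by rewrite ltNge; have [_ _ ->] := p_P n.
Unshelve. all: by end_near. Qed.

End feller.

(** * Necessity of the continuity of the survival functions *)

Section lower_integral_gain.
Context {d} {T : measurableType d} {R : realType} (P : probability T R).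
Import HBNNSimple.

(** F is arbitrary, so additivity is unavailable: a simple h below F is compared
    with the positive part of h + c * 1_A - e, which is simple and below H. *)
Lemma lower_integral_gain (F H : T -> R) (A : set T) (c e : R) :
  measurable A -> 0 <= c -> 0 <= e -> (forall x, 0 <= F x) -> (forall x, 0 <= H x) ->
  (forall x, F x + c * \1_A x <= H x + e) ->
  (\int[P]_x (F x)%:E + c%:E * P A <= \int[P]_x (H x)%:E + e%:E)%E.
Proof.
move=> mA c0 e0 F0 H0 FH.
have cPA : (c%:E * P A)%E \is a fin_num by rewrite fin_numM// fin_num_measure.
rewrite -leeBrDr//; apply: lower_integral_ub => [x|h hF]; first by rewrite lee_fin.
rewrite leeBrDr//.
pose g x := Num.max (h x + c * \1_A x - e) 0.
have mh : measurable_fun setT h by exact: measurable_funP.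
have mcA : measurable_fun setT (fun x => c * (\1_A x : R)).
  by apply: measurable_funM => //; exact: measurable_indic.
have mg : measurable_fun setT g.
  by apply: measurable_maxr => //; apply: measurable_funB => //; exact: measurable_funD.
have gH : (\int[P]_x (g x)%:E <= \int[P]_x (H x)%:E)%E.
  apply: lower_integral_le => x; rewrite lee_fin /g ?le_max ?lexx ?orbT//.
  rewrite ge_max H0 andbT lerBlDr (le_trans _ (FH x))// lerD2r.
  by rewrite -lee_fin.
apply: le_trans (leeD2r _ gH).
have -> : (c%:E * P A = \int[P]_x (c * \1_A x)%:E)%E.
  under eq_integral do rewrite EFinM.
  rewrite ge0_integralZl_EFin//; last by apply/measurable_EFinP; exact: measurable_indic.
  by rewrite integral_indic// setIT.
have -> : (e%:E = \int[P]_x (cst e%:E x))%E.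
  by rewrite integral_cst//= [X in (_ * X)%E](probability_setT P) mule1.
have g0 x : (0 <= (g x)%:E)%E by rewrite lee_fin /g le_max lexx orbT.
have h0 x : (0 <= (h x)%:E)%E by rewrite lee_fin.
have cA0 x : (0 <= (c * \1_A x)%:E)%E by rewrite lee_fin mulr_ge0.
have e0' (x : T) : (0 <= cst e%:E x)%E by rewrite lee_fin.
have mgE : measurable_fun setT (fun x => (g x)%:E) by exact/measurable_EFinP.
have mhE : measurable_fun setT (fun x => (h x)%:E) by exact/measurable_EFinP.
have mcE : measurable_fun setT (fun x => (c * \1_A x)%:E) by exact/measurable_EFinP.
rewrite -(ge0_integralD P measurableT (fun x _ => h0 x) mhE (fun x _ => cA0 x) mcE).
rewrite -(ge0_integralD P measurableT (fun x _ => g0 x) mgE (fun x _ => e0' x) (@measurable_cst _ _ _ _ _ _)).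
apply: lower_integral_le => x; first exact: adde_ge0.
by rewrite -!EFinD lee_fin -lerBlDr /g le_max lexx.
Qed.

Lemma lower_integral_fin (F : T -> R) (M : R) : (forall x, 0 <= F x <= M) ->
  (\int[P]_x (F x)%:E)%E \is a fin_num.
Proof.
move=> FM; rewrite ge0_fin_numE; last first.
  by apply: integral_ge0 => x _; rewrite lee_fin; have /andP[] := FM x.
apply: (@le_lt_trans _ _ (\int[P]_x (cst M%:E x))%E).
  by apply: lower_integral_le => x; rewrite lee_fin; have /andP[] := FM x.
by rewrite integral_cst//= [X in (_ * X)%E](probability_setT P) mule1 ltry.
Qed.

End lower_integral_gain.

Section converse.
Context {R : realType} {d N : nat} (D : switching R d N)
  {dO : measure_display} {Omega : measurableType dO}
  (P : probability Omega R) (U V : nat -> {RV P >-> R}).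
Hypothesis UV_iid : iid_uniform_pair U V.
Hypothesis Z_feller : feller (semigroup D U V).
Local Notation space := ('rV[R]_d * R * discrete_topology 'I_N)%type.
Implicit Types (z : K D) (t : R).

Lemma state_at_default (u v : nat -> R) z t :
  (forall k, ~~ (jump_time u v z k <= t < jump_time u v z k.+1)) ->
  state_at u v z t = z.
Proof.
move=> nok; rewrite /state_at xgetPN; first exact: valKd.
by move=> y [k kt _]; have /negP := nok k.
Qed.

Section jump.
Variables (i : 'I_N) (a e : R).
Hypotheses (a0 : 0 < a) (e0 : 0 < e) (gap : forall b, b < a -> G D i a + e <= G D i b).

Let start : space := (0, 0, i).

Let z0 : K D := SigSub (mem_set (post_jump_in_K D 0 i)).

Let atom_set : set R := [set r | 0 <= r /\ a <= hazard D i 0 0 r].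
Let atom_time : R := inf atom_set.

Let atom_time_gt0 : 0 < atom_time.
Proof.
have [c c0 cP] := lambda_lower D; have [L L0 LP] := lambda_upper D.
have life0 : (0%:E < life D i 0)%E by exact: life_gt0 (phi_flow D i) 0.
apply: (@lt_le_trans _ _ (a / L)); first by rewrite divr_gt0.
apply: lb_le_inf => [|r [r0 ar]].
  exists (a / c); split; first by rewrite divr_ge0// ltW.
  apply: le_trans (hazard_lower (cP i) life0 _).
    by rewrite add0r mulrC divfK// gt_eqF.
  by rewrite oppr0 divr_ge0// ltW.
rewrite ler_pdivrMr// mulrC (le_trans ar)// -[X in _ * X]add0r.
by apply: (hazard_upper (LP i) life0); rewrite oppr0.
Qed.

(* every u in the gap of G has the same generalized inverse *)
Let psi_atom u : G D i a <= u < G D i a + e -> psi D start u = atom_time.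
Proof.
move=> /andP[au ue]; rewrite /psi; congr inf; apply/seteqP; split => r /= [r0 Gr];
  split => //; move: Gr; rewrite hazard00 survival0 divr1.
- move=> Gu; rewrite leNgt; apply/negP => /gap Gea.
  by have := le_lt_trans (le_trans Gea Gu) ue; rewrite ltxx.
- by move=> ah; apply: le_trans au; exact: survival_nonincreasing.
Qed.

(* the truncation makes the age bounded without affecting it up to time atom_time *)
Let age (y : K D) : R := Num.min (val y).1.2 atom_time.

Let age_ge0 y : 0 <= age y.
Proof.
rewrite /age le_min (ltW atom_time_gt0) andbT.
by have := K_val y; case: (val y) => -[x s] j /in_K[].
Qed.

Let age_le y : age y <= atom_time.
Proof. by rewrite /age ge_min lexx orbT. Qed.

Let age_continuous : continuous age.
Proof.
move=> y; apply: (@continuous_min _ _ (fun y : K D => (val y).1.2) (cst atom_time)).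
  have vy : val y' @[y' --> y] --> val y.
    exact: (@initial_continuous _ _ (set_val : K D -> space) y).
  have vy1 : (val y').1 @[y' --> y] --> (val y).1 by exact: cvg_comp vy cvg_fst.
  exact: cvg_comp vy1 cvg_snd.
exact: cst_continuous.
Qed.

Let age_slot (u v : nat -> R) t k : unit_seq u ->
  jump_time u v z0 k <= t < jump_time u v z0 k.+1 ->
  age (state_at u v z0 t) = Num.min (t - jump_time u v z0 k) atom_time.
Proof.
move=> u01 kt; rewrite /age (val_state_at u01 kt); congr Num.min.
case: k kt => [|k] kt; last by rewrite post_jumpS /= add0r.
by rewrite post_jump0 /= add0r.
Qed.

(* jumps only decrease the age; an explosion before the final time leaves the
   default state, of age 0, so that the bound holds on every path *)
Let age_growth (u v : nat -> R) t : unit_seq u -> 0 <= t < atom_time ->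
  age (state_at u v z0 atom_time) <= age (state_at u v z0 t) + (atom_time - t).
Proof.
move=> u01 /andP[t0 tT].
have [[k kT]|nok] := pselect (exists k,
    jump_time u v z0 k <= atom_time < jump_time u v z0 k.+1); last first.
  rewrite [state_at u v z0 atom_time]state_at_default; last first.
    by move=> k; apply/negP => kT; apply: nok; exists k.
  rewrite [leLHS]/age /= min_l ?(ltW atom_time_gt0)//.
  by rewrite addr_ge0// subr_ge0 ltW.
have [kt|tk] := leP (jump_time u v z0 k) t.
  rewrite (age_slot u01 kT) (@age_slot u v t k)//; last first.
    by rewrite kt; case/andP: kT => _; exact: lt_trans.
  by rewrite /Num.min; case: ifPn; case: ifPn; have := jump_time_ge0 u v z0 k; lra.
rewrite (age_slot u01 kT) (@le_trans _ _ (atom_time - jump_time u v z0 k))//.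
  by rewrite ge_min lexx.
by have := age_ge0 (state_at u v z0 t); lra.
Qed.

Let age_atom (u v : nat -> R) t : unit_seq u -> 0 <= t < atom_time ->
  G D i a <= u 1%N < G D i a + e ->
  age (state_at u v z0 t) = t /\ age (state_at u v z0 atom_time) = 0.
Proof.
move=> u01 /andP[t0 tT] ua.
have T1 : jump_time u v z0 1 = atom_time.
  by rewrite jump_timeS jump_time0 add0r post_jump0 (psi_atom ua).
split.
  rewrite (@age_slot u v t 0)// ?jump_time0 ?T1 ?t0//.
  by rewrite subr0 min_l// ltW.
have [[k kT]|nok] := pselect (exists k,
    jump_time u v z0 k <= atom_time < jump_time u v z0 k.+1); last first.
  rewrite state_at_default; last by move=> k; apply/negP => kT; apply: nok; exists k.
  by rewrite /age /= min_l// ltW.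
rewrite (age_slot u01 kT).
case: k kT => [|k]; first by rewrite T1 ltxx andbF.
move=> /andP[kT _].
have Tk : atom_time <= jump_time u v z0 k.+1.
  by rewrite -T1; exact: jump_time_nondecreasing.
have -> : jump_time u v z0 k.+1 = atom_time by apply/eqP; rewrite eq_le kT.
by rewrite subrr min_l// ltW.
Qed.

(* the event that U_1 falls in the gap has probability e *)
Let semigroup_gap t : 0 <= t < atom_time ->
  semigroup D U V atom_time age z0 + atom_time * e <=
  semigroup D U V t age z0 + (atom_time - t).
Proof.
move=> tT; pose A := U 1%N @^-1` `[G D i a, G D i a + e[%classic.
have mA : measurable A by apply: measurable_sfunP; exact: measurable_itv.
have PA : P A = e%:E.
  rewrite /A (uniform_unit_interval (draw_unif UV_iid (inl 1%N)))//.
    rewrite lebesgue_measure_itv/= lte_fin ltrDl e0 -EFinD.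
    by congr EFin; ring.
  move=> r /=; rewrite !in_itv/= => /andP[ar re].
  rewrite (le_trans (survival_ge0 _ _ _) ar)/=.
  by rewrite (le_trans (ltW re))// (le_trans (gap a0))// survival_le1.
have fin s : (\int[P]_w (age (state_at (U ^~ w) (V ^~ w) z0 s))%:E)%E \is a fin_num.
  by apply: (lower_integral_fin _ (M := atom_time)) => w; rewrite age_ge0 age_le.
rewrite /semigroup !expectationTE -lee_fin !EFinD !fineK// EFinM -PA -EFinD.
apply: lower_integral_gain => //.
- exact: ltW.
- by rewrite subr_ge0; case/andP: tT => _ /ltW.
move=> w; rewrite indicE; have [wA|wA] := boolP (w \in A).
  have [|-> ->] := @age_atom (U ^~ w) (V ^~ w) t (U_unit UV_iid w) tT.
    by move: wA; rewrite inE /A /= in_itv.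
  by rewrite mulr1; lra.
rewrite mulr0 addr0; apply: age_growth => //; exact: (U_unit UV_iid w).
Qed.

Lemma no_survival_gap : False.
Proof.
have [|cont _] := Z_feller age_continuous.
  exists atom_time; split; first by rewrite num_real.
  move=> M TM y _ /=; rewrite (ger0_norm (age_ge0 y)).
  exact: le_trans (age_le y) (ltW TM).
pose t_ n := atom_time - atom_time / n.+2%:R.
have t_P n : 0 <= t_ n < atom_time.
  rewrite /t_ subr_ge0 ler_pdivrMr// ler_peMr ?ler1n ?(ltW atom_time_gt0)//=.
  by rewrite ltrBlDr ltrDl divr_gt0.
have dt : atom_time / n.+2%:R @[n --> \oo] --> 0.
  rewrite -[X in _ --> X](mulr0 atom_time); apply: cvgM; first exact: cvg_cst.
  by have := @cvg_harmonic R; rewrite -(cvg_shiftS (harmonic : nat -> R)).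
have tt : t_ n @[n --> \oo] --> atom_time.
  by rewrite -[X in _ --> X]subr0; apply: cvgB => //; exact: cvg_cst.
have sc : semigroup D U V (t_ n) age z0 @[n --> \oo] --> semigroup D U V atom_time age z0.
  have /subspace_continuousP/(_ (atom_time, z0) (ltW atom_time_gt0)) := cont.
  move=> sc; apply: (cvg_comp (fun n => (t_ n, z0)) _ _ sc) => B /= wB.
  have : \forall n \near \oo, 0 <= t_ n -> B (t_ n, z0).
    have cz : (fun n : nat => z0) @ \oo --> z0 by exact: cvg_cst.
    exact: (@cvg_pair _ _ _ \oo (nbhs atom_time) (nbhs z0) _ _ _ t_ _ tt cz _ wB).
  by apply: filterS => n; apply; have /andP[] := t_P n.
have : semigroup D U V atom_time age z0 + atom_time * e <=
    semigroup D U V atom_time age z0 + 0.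
  apply: (cvgr_to_ge (cvgD sc dt)); apply: nearW => n.
  have := semigroup_gap (t_P n); have -> : atom_time - t_ n = atom_time / n.+2%:R by rewrite /t_; ring.
  exact.
by rewrite addr0 gerDl leNgt mulr_gt0.
Qed.

End jump.

(** A nonincreasing right-continuous function that is not left-continuous at a has
    a gap there. *)
Lemma survival_continuous i : {within `[0, +oo[, continuous (G D i)}.
Proof.
apply/continuous_within_itvcyP; split; last exact: survival_right_continuous.
move=> a; rewrite in_itv/= andbT => a0.
apply/left_right_continuousP; split; last exact: survival_right_continuous.
apply/cvgrPdist_le => e e0.
have [b ba be] : exists2 b, b < a & G D i b < G D i a + e.
  apply: contrapT => nob.
  have gap b : b < a -> G D i a + e <= G D i b.
    by move=> ba; rewrite leNgt; apply/negP => be; apply: nob; exists b.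
  exact: (no_survival_gap a0 e0 gap).
near=> c.
have ca : c <= a by apply: ltW; near: c; exact: nbhs_left_lt.
have bc : b <= c by near: c; exact: nbhs_left_ge.
rewrite distrC ger0_norm ?subr_ge0 ?survival_nonincreasing//.
by rewrite lerBlDl (le_trans _ (ltW be))// survival_nonincreasing.
Unshelve. all: by end_near. Qed.

End converse.

Theorem proposition5 (R : realType) (d N : nat) (D : switching R d N)
    (dO : measure_display) (Omega : measurableType dO)
    (P : probability Omega R) (U V : nat -> {RV P >-> R})
    (UV_iid : iid_uniform_pair U V) :
  feller (semigroup D U V) <->
  (forall i : 'I_N, {within `[0, +oo[, continuous (G D i)}).
Proof.
split=> [Z_feller i|G_continuous f cf [M [_ fM]]].
  exact: (survival_continuous UV_iid Z_feller).
pose M1 := `|M| + 1.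
have M10 : 0 <= M1 by rewrite addr_ge0.
have fM1 z : `|f z| <= M1.
  by apply: fM => //; rewrite (le_lt_trans (ler_norm M))// ltrDl.
split; first exact: (semigroup_continuous UV_iid G_continuous cf M10 fM1).
exists M1; split; first by rewrite num_real.
move=> M2 M12 p /= p0; apply: le_trans (ltW M12).
exact: (semigroup_bounded UV_iid G_continuous cf M10 fM1).
Qed.
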